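(* Each totally non-degenerate $d$-dimensional polytope $P\subseteq\mathbb{R}^d$ with $n$ facets admits a simple $(d+1)$-dimensional extension $Q$ with $n+1$ facets and diameter at most $2(n-d)$.
   Context: For $A\in\mathbb{R}^{m\times d}$ with nonzero rows $A_1,\dots,A_m$ and $b\in\mathbb{R}^m$, let $\mathcal{H}(A,b)$ be the family of hyperplanes $\{x\in\mathbb{R}^d\mid A_ix=b_i\}$, $i=1,\dots,m$. A feasible system $Ax\le b$ is totally non-degenerate if, for any collection of $k$ hyperplanes of $\mathcal{H}(A,b)$, their intersection is a $(d-k)$-dimensional affine subspace when $1\le k\le d$ and is empty when $k>d$. A polytope $P\subseteq\mathbb{R}^d$ is totally non-degenerate if there is a totally non-degenerate system of linear inequalities $Ax\le b$ with $P=\{x\in\mathbb{R}^d\mid Ax\le b\}$. A polytope $Q$ is an extension of $P$ if $Q$ can be mapped linearly onto $P$. A $q$-dimensional polytope is simple if each of its vertices is contained in exactly $q$ facets. The diameter of a polytope is the smallest number $\delta$ such that every two vertices are connected by a path with at most $\delta$ edges in the graph formed by the vertices and edges (one-dimensional faces) of the polytope. *)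

(* Defs.v *)
From mathcomp Require Import all_boot all_order all_algebra.
From mathcomp Require Import all_classical all_reals all_analysis.
Set Implicit Arguments.
Unset Strict Implicit.
Unset Printing Implicit Defensive.
Import Order.TTheory GRing.Theory Num.Theory.
Import numFieldNormedType.Exports.
Local Open Scope classical_set_scope.
Local Open Scope card_scope.
Local Open Scope ring_scope.

Section Affine.
Variables (R : realType) (d : nat).
Implicit Types (S V : set 'cV[R]_d).

Definition affine_subspace (k : nat) V : Prop :=
  exists (x0 : 'cV[R]_d) (W : {vspace 'cV[R]_d}),
    \dim W = k /\ V = [set x | x - x0 \in W].

Definition affine_hull S : set 'cV[R]_d :=
  smallest [set V | V = set0 \/ exists k, affine_subspace k V] S.

(* The dimension is an integer, so that the empty set can have dimension -1. *)
Definition has_dim S (q : int) : Prop :=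
  (S = set0 /\ q = -1) \/
  (exists k : nat, q = k%:Z /\ affine_subspace k (affine_hull S)).

End Affine.

Section Polytope.
Variables (R : realType) (d : nat).
Implicit Types (P F : set 'cV[R]_d) (v w : 'cV[R]_d).

Definition hyperplane (a : 'rV[R]_d) (beta : R) : set 'cV[R]_d :=
  [set x | (a *m x) 0 0 = beta].

Definition polyhedron (m : nat) (A : 'M[R]_(m, d)) (b : 'cV[R]_m) :
    set 'cV[R]_d :=
  [set x | forall i, (A *m x) i 0 <= b i 0].

Definition polytope P : Prop :=
  bounded_set P /\
  exists (m : nat) (A : 'M[R]_(m, d)) (b : 'cV[R]_m), P = polyhedron A b.

(* [c = 0] is allowed: both [P] and the empty set are faces of a nonempty
   [P].  In particular the facet of a single point is the empty set. *)
Definition face P F : Prop :=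
  exists (c : 'rV[R]_d) (gamma : R),
    (forall x, P x -> (c *m x) 0 0 <= gamma) /\ F = P `&` hyperplane c gamma.

Definition facet P F : Prop :=
  face P F /\ exists q : int, has_dim P q /\ has_dim F (q - 1).

Definition vertex P v : Prop := face P [set v].

Definition edge P F : Prop := face P F /\ has_dim F 1.

Definition adjacent P v w : Prop :=
  [/\ vertex P v, vertex P w, v <> w & exists F, [/\ edge P F, F v & F w]].

Definition connected_within P (delta : nat) : Prop :=
  forall v w, vertex P v -> vertex P w ->
    exists p : seq 'cV[R]_d,
      [/\ path (fun x y => `[< adjacent P x y >]) v p, last v p = w
        & (size p <= delta)%N].

Definition is_diameter P (delta : nat) : Prop :=
  connected_within P delta /\
  forall delta', connected_within P delta' -> (delta <= delta')%N.

Definition simple_polytope (q : nat) P : Prop :=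
  [/\ polytope P, has_dim P q%:Z &
    forall v, vertex P v -> [set F | facet P F /\ F v] #= `I_q].

(* The hyperplanes form a family indexed by the rows: a collection of [k]
   hyperplanes is a set of [k] row indices. *)
Definition totally_nondegenerate_system (m : nat) (A : 'M[R]_(m, d))
    (b : 'cV[R]_m) : Prop :=
  [/\ polyhedron A b !=set0,
      forall i, row i A != 0 &
      forall K : {set 'I_m},
        let I := \bigcap_(i in [set` K]) hyperplane (row i A) (b i 0) in
        ((1 <= #|K| <= d)%N -> affine_subspace (d - #|K|) I) /\
        ((d < #|K|)%N -> I = set0)].

Definition totally_nondegenerate P : Prop :=
  polytope P /\
  exists (m : nat) (A : 'M[R]_(m, d)) (b : 'cV[R]_m),
    totally_nondegenerate_system A b /\ P = polyhedron A b.

End Polytope.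

Definition extension (R : realType) (e d : nat) (Q : set 'cV[R]_e)
    (P : set 'cV[R]_d) : Prop :=
  polytope Q /\ exists f : {linear 'cV[R]_e -> 'cV[R]_d}, f @` Q = P.

(* Main.v *)
(** Translate an interior point [x0] of [P] to the origin and lift the [i]-th
  inequality [A_i y <= beta_i] to [A_i y <= beta_i + delta_i s] in the half
  space [s >= 0], with [delta_i = 0] on [d + 1] rows that bound a simplex.
  As [s] grows the slices swell from [P] to that simplex, so the lifted
  polyhedron is unbounded only in the direction of [s]; the projective map
  [(y, s) |-> (s, y) / (1 + eta s)] turns it into the polytope
  [Q = {(z, x) | z >= 0, A_i x + (eta beta_i - delta_i) z <= b_i}] and the
  point at infinity into a vertex [o].  For large [eta] the coefficients of [z]
  are positive and [Q] projects onto its base [P].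

  The [delta_i] are chosen one row at a time, each huge compared to the
  previous ones, so that the new row cuts off no vertex above the base.  A
  vertex lying on the new row then climbs, along one edge if it is above the
  base and along two edges otherwise, to an old vertex above the base (or to
  [o]).  By induction every vertex of [Q] reaches [o] along at most [n - d]
  edges. *)
Require Import Defs.
From mathcomp Require Import all_boot all_order all_algebra.
From mathcomp Require Import all_classical all_reals all_analysis.
From mathcomp Require Import ring lra.

Set Implicit Arguments.
Unset Strict Implicit.
Unset Printing Implicit Defensive.
Import Order.TTheory GRing.Theory Num.Theory.
Import numFieldNormedType.Exports.
Local Open Scope ring_scope.

(** * Row evaluations, finite thresholds and ray shooting *)

Lemma mulmx_addZ (R : realType) m d (A : 'M[R]_(m, d)) (x u : 'cV_d) (l : R) i :
  (A *m (x + l *: u)) i 0 = (A *m x) i 0 + l * (A *m u) i 0.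
Proof. by rewrite mulmxDr -scalemxAr !mxE. Qed.

Lemma mulmx_subZ (R : realType) m d (A : 'M[R]_(m, d)) (x u : 'cV_d) (l : R) i :
  (A *m (x - l *: u)) i 0 = (A *m x) i 0 - l * (A *m u) i 0.
Proof. by rewrite -scaleNr mulmx_addZ mulNr. Qed.

Lemma eventually_forall_fin (R : realType) (T : finType) (P : T -> R -> Prop) :
  (forall t, exists D0, forall D, D0 <= D -> P t D) ->
  exists2 D0 : R, 0 < D0 & forall D, D0 <= D -> forall t, P t D.
Proof.
move=> /fin_all_exists[f fP]; exists (1 + \sum_t `|f t|).
  by rewrite ltr_pwDl // sumr_ge0.
move=> D leD t; apply: fP; apply: le_trans leD.
rewrite (le_trans (ler_norm _))// (bigD1 t)//= addrCA lerDl addr_ge0//.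
exact: sumr_ge0.
Qed.

(** The ratio test of linear programming: [f] holds the slacks at a point, [g] their rates of
    decrease along a ray. The ray never leaves, or it stops at the least ratio [f i / g i] with
    [g i > 0]. *)
Lemma ray_shooting (R : realType) n (J : {set 'I_n}) (f g : 'I_n -> R) :
  (forall i, i \in J -> 0 <= f i) ->
  (forall i, i \in J -> g i <= 0) \/
  exists (l : R) i, [/\ 0 <= l, i \in J, 0 < g i, f i = l * g i &
    forall j, j \in J -> l * g j <= f j].
Proof.
move=> f0.
have [[i0 i0P]|no] := pselect (exists i, (i \in J) && (0 < g i)); last first.
  left=> i iJ; rewrite leNgt; apply/negP => gi; apply: no.
  by exists i; rewrite iJ.
right.
case: (@Order.TotalTheory.arg_minP _ R _ i0 (fun i => (i \in J) && (0 < g i))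
  (fun i => f i / g i) i0P) => i /andP[iJ gi] imin.
exists (f i / g i), i; split=> //.
- by rewrite divr_ge0 ?f0 // ltW.
- by rewrite divfK // gt_eqF.
- move=> j jJ; have [gj|gj] := ltP 0 (g j).
    by rewrite -ler_pdivlMr//; apply: imin; rewrite jJ.
  by rewrite (le_trans _ (f0 _ jJ))// mulr_ge0_le0// divr_ge0 ?f0 // ltW.
Qed.

(** * Climbing a lifted polyhedron *)

Section Climb.
Variables (R : realType) (n d : nat) (A : 'M[R]_(n, d)) (beta : 'I_n -> R).
Implicit Types (J K T : {set 'I_n}) (delta : 'I_n -> R) (y u : 'cV[R]_d).

Definition lifted_feasible J delta y (s : R) :=
  forall i, i \in J -> (A *m y) i 0 <= beta i + delta i * s.

Definition lifted_tight delta y (s : R) : {set 'I_n} :=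
  [set i | (A *m y) i 0 == beta i + delta i * s].

Lemma lifted_tightP delta y s K : reflect
  (forall i, i \in K -> (A *m y) i 0 = beta i + delta i * s)
  (K \subset lifted_tight delta y s).
Proof.
by apply: (iffP fintype.subsetP) => H i iK; have := H i iK;
  rewrite inE => /eqP.
Qed.

(* [climb J delta k y s]: at most [k] edges, upward in [s], lead from [(y, s)] to
   the vertex at infinity; [climb_top] is the last, unbounded edge. *)
Inductive climb J delta : nat -> 'cV[R]_d -> R -> Prop :=
| climb_top k y s K : K \subset J -> #|K| = d ->
    K \subset lifted_tight delta y s ->
    (forall i, i \in K -> delta i = 0) -> climb J delta k.+1 y s
| climb_step k y s y' s' K : K \subset J -> #|K| = d ->
    K \subset lifted_tight delta y s -> K \subset lifted_tight delta y' s' ->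
    0 < s' -> s < s' -> lifted_feasible J delta y' s' ->
    (d < #|J :&: lifted_tight delta y' s'|)%N ->
    climb J delta k y' s' -> climb J delta k.+1 y s.

Lemma climb_monotone J delta k k' y s :
  (k <= k')%N -> climb J delta k y s -> climb J delta k' y s.
Proof.
move=> lekk H; elim: H k' lekk => {k y s}
  [k y s K KJ Kd Kt K0|k y s y' s' K KJ Kd Kt Kt' s'0 ss' fe td _ IH] [//|k'] lek.
  exact: climb_top K0.
exact: (climb_step KJ Kd Kt Kt' s'0 ss' fe td (IH _ lek)).
Qed.

(** The form in which total non-degeneracy enters the construction. It also covers the single zero
    row [0 <= 1] in dimension 0. *)
Record generic_system := GenericSystem {
  generic_solve : forall K, (#|K| <= d)%N -> forall c : 'I_n -> R,
    exists u : 'cV_d, forall i, i \in K -> (A *m u) i 0 = c i;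
  generic_inj : forall K u, #|K| = d ->
    (forall i, i \in K -> (A *m u) i 0 = 0) -> u = 0;
  generic_tight : forall K y,
    (forall i, i \in K -> (A *m y) i 0 = beta i) -> (#|K| <= d)%N }.

Hypothesis genA : generic_system.

Lemma generic_inj_ge K u : (d <= #|K|)%N ->
  (forall i, i \in K -> (A *m u) i 0 = 0) -> u = 0.
Proof.
move=> dK; have : (0 < #|[set T : {set 'I_n} | (T \subset K) && (#|T| == d)]|)%N.
  by rewrite cards_draws bin_gt0.
rewrite card_gt0 => /set0Pn[T]; rewrite inE => /andP[/fintype.subsetP TK /eqP Td] H.
by apply: (generic_inj genA Td) => i /TK; exact: H.
Qed.

(* Sliding a common solution down to level [s = 0] along a kernel vector would
   make [d + 1] rows of the base tight. *)
Lemma lifted_kernel_trivial delta T y s u sg : (d < #|T|)%N ->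
  T \subset lifted_tight delta y s ->
  (forall i, i \in T -> (A *m u) i 0 = delta i * sg) -> u = 0 /\ sg = 0.
Proof.
move=> dT /lifted_tightP yT uT.
have sg0 : sg = 0.
  apply/eqP; apply: contraTT dT => sg0; rewrite -leqNgt.
  apply: (generic_tight genA (y := y - (s / sg) *: u)) => i iT.
  by rewrite mulmx_subZ yT// uT//; field.
split=> //; apply: (generic_inj_ge (ltnW dT)) => i iT.
by rewrite uT // sg0 mulr0.
Qed.

Lemma lifted_tight_uniq delta T y s y' s' : (d < #|T|)%N ->
  T \subset lifted_tight delta y s -> T \subset lifted_tight delta y' s' ->
  y' = y /\ s' = s.
Proof.
move=> dT yT y'T.
have [] := @lifted_kernel_trivial delta T y s (y' - 1 *: y) (s' - s) dT yT.
  move=> i iT; rewrite mulmx_subZ.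
  by rewrite (lifted_tightP _ _ _ _ yT)// (lifted_tightP _ _ _ _ y'T)//; ring.
by rewrite scale1r => /subr0_eq-> /subr0_eq->.
Qed.

Variable I0 : {set 'I_n}.
Hypothesis cardI0 : #|I0| = d.+1.
Hypothesis simplexI0 : forall u, (forall i, i \in I0 -> (A *m u) i 0 <= 0) -> u = 0.

(** Invariant of the insertion of rows, used with [r] the number of rows of [J] outside [I0]. The
    cardinality bound leads to simplicity. For [r = 0] the last clause says that there is no vertex
    above the base, as no climb has length 0. *)
Definition good_lift J delta r :=
  [/\ forall i, i \in I0 -> delta i = 0,
      forall i, i \in J -> i \notin I0 -> 0 < delta i,
      forall y (s : R), 0 < s -> (#|J :&: lifted_tight delta y s| <= d.+1)%N,
      forall y, lifted_feasible J delta y 0 ->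
        (d <= #|J :&: lifted_tight delta y 0|)%N -> climb J delta r.+1 y 0 &
      forall y (s : R), 0 < s -> lifted_feasible J delta y s ->
        (d < #|J :&: lifted_tight delta y s|)%N -> climb J delta r y s].

(** With zero coefficients the lift is a prism over the simplex: nothing above the base is a vertex,
    and each base vertex starts a vertical unbounded edge. *)
Lemma good_lift_simplex : good_lift I0 (fun=> 0%R) 0.
Proof.
have t0 y (s : R) : (#|I0 :&: lifted_tight (fun=> 0%R) y s| <= d)%N.
  apply: (generic_tight genA (y := y)) => i; rewrite !inE => /andP[_ /eqP->].
  by rewrite mul0r addr0.
split=> //.
- by move=> i /[swap] /negbTE->.
- by move=> y s _; rewrite leqW.
- move=> y _ dy; apply: (@climb_top _ _ _ _ _ (I0 :&: lifted_tight (fun=> 0%R) y 0)) => //.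
  + exact: finset.subsetIl.
  + by apply/eqP; rewrite eqn_leq t0.
  + exact: finset.subsetIr.
- by move=> y s _ _; rewrite ltnNge t0.
Qed.

(* For a large coefficient [D] the new row [j] cuts off no vertex strictly above
   the base. *)
Lemma steep_row_slack delta j : exists2 D0 : R, 0 < D0 & forall D, D0 <= D ->
  forall y (s : R) T, 0 < s -> (d < #|T|)%N -> T \subset lifted_tight delta y s ->
  (A *m y) j 0 < beta j + D * s.
Proof.
have [T|D0 D00 D0P] := @eventually_forall_fin R {set 'I_n} (fun T D =>
  forall y (s : R), 0 < s -> (d < #|T|)%N -> T \subset lifted_tight delta y s ->
  (A *m y) j 0 < beta j + D * s); last first.
  by exists D0 => // D leD y s T; exact: D0P.
(* By [lifted_tight_uniq] the set [T] determines the point, so one threshold per [T] suffices. *)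
have [[[y s] /= [s0 dT yT]]|no] := pselect (exists p : 'cV[R]_d * R,
  [/\ 0 < p.2, (d < #|T|)%N & T \subset lifted_tight delta p.1 p.2]); last first.
  by exists 0 => D _ y s s0 dT yT; case: no; exists (y, s).
exists ((`|(A *m y) j 0 - beta j| + 1) / s) => D leD y' s' s'0 _ y'T.
have [-> ->] := lifted_tight_uniq dT yT y'T.
move: leD; rewrite ler_pdivrMr// -ltrBlDl => leD.
by rewrite (le_lt_trans (ler_norm _))// (lt_le_trans _ leD)// ltrDl.
Qed.

(** Old vertices above the base survive and keep their climbs. From a vertex on the new row [j], one
    edge (two if it is on the base) leads to such an old vertex or to infinity. *)
Lemma good_lift_extend delta J j r : I0 \subset J -> j \notin J ->
  good_lift J delta r -> exists delta', good_lift (j |: J) delta' r.+1.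
Proof.
move=> I0J jJ [delta0 deltap tightp climb0 climbp].
have [D D0 steep] : exists2 D : R, 0 < D & forall y (s : R) T, 0 < s -> (d < #|T|)%N ->
    T \subset lifted_tight delta y s -> (A *m y) j 0 < beta j + D * s.
  by have [D D0 DP] := steep_row_slack delta j; exists D => //; exact: DP.
pose delta' i : R := if i == j then D else delta i.
have dJ i : i \in J -> delta' i = delta i.
  by rewrite /delta'; case: eqP => // ->; rewrite (negbTE jJ).
have dj : delta' j = D by rewrite /delta' eqxx.
have EJ y s : J :&: lifted_tight delta' y s = J :&: lifted_tight delta y s.
  by apply/setP=> i; rewrite !inE; case: (boolP (i \in J)) => //= /dJ->.
have KE K y s : K \subset J ->
    (K \subset lifted_tight delta' y s) = (K \subset lifted_tight delta y s).
  by move=> KJ; have := finset.subsetI K J (lifted_tight delta' y s);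
    rewrite EJ finset.subsetI KJ => /= <-.
have tightE y s : (j |: J) :&: lifted_tight delta' y s =
    if j \in lifted_tight delta' y s then j |: (J :&: lifted_tight delta y s)
    else J :&: lifted_tight delta y s.
  rewrite -EJ; apply/setP=> i; case: ifPn => jt; rewrite !inE;
  case: eqP => [->|]//=; rewrite ?(negbTE jJ) /=.
    by move: jt; rewrite inE.
  by move: jt; rewrite inE => /negbTE.
have feasE y s : lifted_feasible J delta y s ->
    (A *m y) j 0 <= beta j + D * s -> lifted_feasible (j |: J) delta' y s.
  by move=> fe fj i; rewrite !inE => /predU1P[->|iJ]; rewrite ?dj// dJ//; exact: fe.
have feasJ y s : lifted_feasible (j |: J) delta' y s -> lifted_feasible J delta y s.
  by move=> fe i iJ; rewrite -dJ//; apply: fe; rewrite !inE iJ orbT.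
have KjJ K : K \subset J -> K \subset j |: J.
  by move=> /fintype.subset_trans; apply; exact: finset.subsetUr.
(* Every later vertex of an old climb lies above the base, where the steep row [j] cuts off no
   vertex. *)
have climbE k y s : climb J delta k y s -> climb (j |: J) delta' k y s.
  elim=> {k y s} [k y s K KJ Kd Kt K0|k y s y' s' K KJ Kd Kt Kt' s'0 ss' fe td _ IH].
    apply: (@climb_top _ _ _ _ _ K) => //; first exact: KjJ.
      by rewrite KE.
    by move=> i iK; rewrite dJ ?K0//; exact: (fintype.subsetP KJ).
  apply: (@climb_step _ _ _ _ _ y' s' K) => //; rewrite ?KE ?KjJ //.
    apply: feasE => //; apply/ltW/(steep y' s' _ s'0 td); exact: finset.subsetIr.
  rewrite -EJ in td; apply: leq_trans td _; apply: subset_leq_card.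
  by apply: finset.setSI; exact: finset.subsetUr.
have up K : #|K| = d -> exists g : 'cV_d, forall i, i \in K -> (A *m g) i 0 = delta i.
  by move=> Kd; exact: (generic_solve genA (eq_leq Kd) delta).
have cardD1 (X : {set 'I_n}) x k : x \notin X -> #|X| = k -> #|x |: X| = k.+1.
  by move=> xX <-; rewrite cardsU1 xX.
exists delta'; split.
- move=> i iI; rewrite dJ ?delta0//; exact: (fintype.subsetP I0J).
- move=> i; rewrite !inE => /predU1P[->|iJ] iI; rewrite ?dj// dJ//; exact: deltap.
- move=> y s s0; rewrite tightE; case: ifPn => [jt|_]; last exact: tightp.
  rewrite cardsU1 inE (negbTE jJ) /= add1n ltnS leqNgt; apply/negP => td.
  have := steep y s _ s0 td (finset.subsetIr _ _).
  by move: jt; rewrite inE dj => /eqP->; rewrite ltxx.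
- move=> y fe; rewrite tightE; case: ifPn => [jt|_ td]; last first.
    by apply: (@climb_monotone _ _ r.+1) => //; apply: climbE; apply: climb0 => //; exact: feasJ.
  set K' := J :&: _; have jK' : j \notin K' by rewrite inE (negbTE jJ).
  move=> dK'.
  have jy : (A *m y) j 0 = beta j by move: jt; rewrite inE => /eqP->; rewrite mulr0 addr0.
  have K'y i : i \in K' -> (A *m y) i 0 = beta i.
    by rewrite !inE => /andP[_ /eqP->]; rewrite mulr0 addr0.
  have K'd : #|j |: K'| = d.
    apply/eqP; rewrite eqn_leq dK' andbT; apply: (generic_tight genA (y := y)) => i.
    by rewrite !inE => /predU1P[->//|iK']; apply: K'y; rewrite !inE.
  (* Direction of the base edge that keeps the other [d - 1] tight rows and leaves through row
     [j]. *)
  have [u uP] := generic_solve genA (eq_leq K'd) (fun i => (i == j)%:R).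
  have uj : (A *m u) j 0 = 1 by rewrite uP ?finset.setU11// eqxx.
  have uK' i : i \in K' -> (A *m u) i 0 = 0.
    by move=> iK'; rewrite uP ?finset.setU1r//; case: eqP iK' jK' => // -> ->.
  have [|dir|[l [i [l0 iJ ui fi lP]]]] := @ray_shooting _ _ J
    (fun i => beta i - (A *m y) i 0) (fun i => (A *m u) i 0).
  + by move=> i /(feasJ _ _ fe); rewrite mulr0 addr0 subr_ge0.
  + have u0 : u = 0.
      by apply: simplexI0 => i iI; apply: dir; exact: (fintype.subsetP I0J).
    by move: uj; rewrite u0 mulmx0 mxE => /esym/eqP; rewrite oner_eq0.
  have iK' : i \notin K' by apply: contraTN ui => /uK'->; rewrite ltxx.
  have {}l0 : 0 < l.
    rewrite lt_neqAle l0 andbT; apply: contra iK' => /eqP l0'.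
    move: fi; rewrite -l0' mul0r => /subr0_eq fi.
    by rewrite !inE iJ fi mulr0 addr0 eqxx.
  (* A base vertex of the old system, violating row [j] by the amount [l]. *)
  pose w := y + l *: u.
  have wJ k : k \in J -> (A *m w) k 0 <= beta k.
    by move=> /lP; rewrite mulmx_addZ; lra.
  pose K := i |: K'.
  have KJ : K \subset J by rewrite finset.subUset finset.sub1set iJ finset.subsetIl.
  have Kd : #|K| = d.
    by move: K'd; rewrite !cardsU1 iK' jK'.
  have Kw k : k \in K -> (A *m w) k 0 = beta k.
    rewrite mulmx_addZ !inE => /predU1P[->|kK]; first by move: fi; lra.
    by rewrite uK' ?inE// K'y ?inE//; lra.
  have wj : (A *m w) j 0 = beta j + l by rewrite mulmx_addZ uj jy mulr1.
  clearbody w.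
  have K'J : K' \subset J by exact: finset.subsetIl.
  have jK : j \notin K by apply: contra jJ; exact: (fintype.subsetP KJ).
  (* The old edge rising from [w] runs through the points [(w + mu *: g, mu)]; row [j] cuts it at a
     height [mu] still to be found. *)
  have [g gP] := up K Kd.
  have below mu : K \subset lifted_tight delta (w + mu *: g) mu.
    by apply/lifted_tightP => k kK; rewrite mulmx_addZ Kw// gP// mulrC.
  (* First edge of the climb: the rows [j |: K'] are tight at [(y, 0)] and at the cut point. *)
  have step mu : 0 < mu -> lifted_feasible J delta (w + mu *: g) mu ->
      (A *m (w + mu *: g)) j 0 = beta j + D * mu ->
      climb (j |: J) delta' r.+1 (w + mu *: g) mu -> climb (j |: J) delta' r.+2 y 0.
    move=> mu0 fx jx; have K'x : K' \subset lifted_tight delta (w + mu *: g) mu.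
      by apply: fintype.subset_trans (below mu); exact: finset.subsetUr.
    have jx' : j \in lifted_tight delta' (w + mu *: g) mu by rewrite inE jx dj eqxx.
    apply: (@climb_step _ _ _ _ _ (w + mu *: g) mu (j |: K')) => //.
    + by rewrite finset.setUS.
    + by rewrite finset.subUset finset.sub1set jt /= KE// finset.subsetIr.
    + by rewrite finset.subUset finset.sub1set jx' KE.
    + by apply: feasE => //; rewrite jx.
    + rewrite tightE jx' cardsU1 inE (negbTE jJ) add1n ltnS; apply: (@leq_trans #|K|); first by rewrite Kd.
      by apply: subset_leq_card; rewrite finset.subsetI KJ below.
  have [|dir|[nu [i' [nu0 i'J gi' fi' nuP]]]] := @ray_shooting _ _ J
    (fun i => beta i - (A *m w) i 0) (fun i => (A *m g) i 0 - delta i).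
  + by move=> k /wJ; rewrite subr_ge0.
  (* The old edge is unbounded, so the simplex rows force [g = 0]. The edge is vertical, [delta]
     vanishes on [K], and row [j] cuts it at height [l / D]. *)
  + have g0 : g = 0.
      apply: simplexI0 => k kI; have := dir k (fintype.subsetP I0J _ kI).
      by rewrite delta0// subr0.
    have lD : 0 < l / D by rewrite divr_gt0.
    apply: (step (l / D)) => //.
    * move=> k kJ; have := wJ _ kJ; have := dir _ kJ; rewrite g0 scaler0 addr0.
      by rewrite mulmx0 mxE; nra.
    * by rewrite g0 scaler0 addr0 wj mulrC divfK// gt_eqF.
    * apply: (@climb_top _ _ _ _ _ K) => //; first exact: KjJ.
        by rewrite KE.
      move=> k kK; rewrite dJ ?(fintype.subsetP KJ)//.
      by have := gP _ kK; rewrite g0 mulmx0 mxE.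
  have i'K : i' \notin K by apply: contraTN gi' => /gP->; rewrite subrr ltxx.
  have Tq : i' |: K \subset lifted_tight delta (w + nu *: g) nu.
    rewrite finset.subUset finset.sub1set below andbT inE mulmx_addZ; apply/eqP.
    by move: fi'; lra.
  have Td : #|i' |: K| = d.+1 by exact: cardD1.
  (* Otherwise [d + 1] rows would be tight at the base point [w]. *)
  have {}nu0 : 0 < nu.
    rewrite lt_neqAle nu0 andbT; apply/negP => /eqP nu0'.
    suff : (#|i' |: K| <= d)%N by rewrite Td ltnn.
    apply: (generic_tight genA (y := w)) => k kT.
    have := lifted_tightP _ _ _ _ Tq k kT.
    by rewrite -nu0' scale0r !addr0 mulr0 addr0.
  have qfe : lifted_feasible J delta (w + nu *: g) nu.
    by move=> k /nuP; rewrite mulmx_addZ; lra.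
  (* Row [j] is violated at [w] but strict at the upper end of the edge, so the cut lies strictly
     between them. *)
  have lt1 : (A *m (w + nu *: g)) j 0 < beta j + D * nu.
    by apply: steep Tq; rewrite ?Td.
  rewrite mulmx_addZ wj in lt1.
  have Dg : 0 < D - (A *m g) j 0.
    by rewrite -(pmulr_rgt0 _ nu0); lra.
  pose mu := l / (D - (A *m g) j 0).
  have muE : mu * (D - (A *m g) j 0) = l by rewrite divfK// gt_eqF.
  have mu0 : 0 < mu by rewrite divr_gt0.
  have munu : mu < nu by rewrite ltr_pdivrMr//; lra.
  have qd : (d < #|J :&: lifted_tight delta (w + nu *: g) nu|)%N.
    by rewrite -Td; apply: subset_leq_card; rewrite finset.subsetI Tq finset.subUset finset.sub1set i'J KJ.
  apply: (step mu) => //.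
  + move=> k kJ; rewrite mulmx_addZ; have := qfe k kJ; rewrite mulmx_addZ.
    have := wJ k kJ; move: mu0 munu; nra.
  + by rewrite mulmx_addZ wj; lra.
  + apply: (@climb_step _ _ _ _ _ (w + nu *: g) nu K) => //; rewrite ?KE ?KjJ//.
    * by apply: feasE => //; rewrite mulmx_addZ wj; lra.
    * rewrite -EJ in qd; apply: leq_trans qd _; apply: subset_leq_card.
      by apply: finset.setSI; exact: finset.subsetUr.
    * by apply: climbE; exact: climbp.
- move=> y s s0 fe; rewrite tightE; case: ifPn => [jt|_ td]; last first.
    by apply: (@climb_monotone _ _ r) => //; apply: climbE; apply: climbp => //; exact: feasJ.
  set K := J :&: _; have jK : j \notin K by rewrite inE (negbTE jJ).
  rewrite cardsU1 jK add1n ltnS => dK.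
  have KJ : K \subset J by exact: finset.subsetIl.
  have Kt : K \subset lifted_tight delta y s by exact: finset.subsetIr.
  have Kd : #|K| = d.
    apply/eqP; rewrite eqn_leq dK andbT leqNgt; apply/negP => td.
    have := steep y s K s0 td Kt.
    by move: jt; rewrite inE dj => /eqP->; rewrite ltxx.
  (* Above the base the [d] old tight rows already cut out an edge of the old lift; it is followed
     upwards. *)
  have [g gP] := up K Kd.
  have [|dir|[nu [i' [nu0 i'J gi' fi' nuP]]]] := @ray_shooting _ _ J
    (fun i => beta i + delta i * s - (A *m y) i 0) (fun i => (A *m g) i 0 - delta i).
  + by move=> k /(feasJ _ _ fe); rewrite subr_ge0.
  + have g0 : g = 0.
      apply: simplexI0 => k kI; have := dir k (fintype.subsetP I0J _ kI).
      by rewrite delta0// subr0.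
    apply: (@climb_top _ _ _ _ _ K) => //; first exact: KjJ.
      by rewrite KE.
    move=> k kK; rewrite dJ ?(fintype.subsetP KJ)//.
    by have := gP _ kK; rewrite g0 mulmx0 mxE.
  have i'K : i' \notin K by apply: contraTN gi' => /gP->; rewrite subrr ltxx.
  have {}nu0 : 0 < nu.
    rewrite lt_neqAle nu0 andbT; apply: contra i'K => /eqP nu0'.
    move: fi'; rewrite -nu0' mul0r => /subr0_eq fi'.
    by rewrite !inE i'J fi' eqxx.
  have Kq : K \subset lifted_tight delta (y + nu *: g) (s + nu).
    apply/lifted_tightP => k kK; rewrite mulmx_addZ gP//.
    by rewrite (lifted_tightP _ _ _ _ Kt)//; lra.
  have Tq : i' |: K \subset lifted_tight delta (y + nu *: g) (s + nu).
    rewrite finset.subUset finset.sub1set Kq andbT inE mulmx_addZ; apply/eqP.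
    by move: fi'; lra.
  have Td : #|i' |: K| = d.+1 by exact: cardD1.
  have qfe : lifted_feasible J delta (y + nu *: g) (s + nu).
    by move=> k /nuP; rewrite mulmx_addZ; lra.
  have snu : 0 < s + nu by rewrite addr_gt0.
  have qd : (d < #|J :&: lifted_tight delta (y + nu *: g) (s + nu)|)%N.
    by rewrite -Td; apply: subset_leq_card; rewrite finset.subsetI Tq finset.subUset finset.sub1set i'J KJ.
  apply: (@climb_step _ _ _ _ _ (y + nu *: g) (s + nu) K) => //; rewrite ?KE ?KjJ//.
  + by rewrite ltrDl.
  + by apply: feasE => //; apply/ltW/(steep _ _ _ snu qd); exact: finset.subsetIr.
  + rewrite -EJ in qd; apply: leq_trans qd _; apply: subset_leq_card.
    by apply: finset.setSI; exact: finset.subsetUr.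
  + by apply: climbE; exact: climbp.
Qed.

Lemma good_lift_exists r : n = (d.+1 + r)%N -> exists delta, good_lift [set: 'I_n] delta r.
Proof.
move=> nr; suff H J : I0 \subset J -> exists delta, good_lift J delta (#|J| - d.+1).
  have -> : r = (#|[set: 'I_n]| - d.+1)%N.
    by apply/esym/eqP; rewrite cardsT card_ord -(eqn_add2l d.+1) subnKC nr// leq_addr.
  exact/H/finset.subsetT.
elim: {J}#|J| {-2}J (erefl #|J|) => [|k IH] J Jk I0J.
  by have := subset_leq_card I0J; rewrite cardI0 Jk.
have [<-|] := eqVneq I0 J.
  by exists (fun=> 0%R); rewrite cardI0 subnn; exact: good_lift_simplex.
rewrite finset.eqEsubset I0J /= => /fintype.subsetPn[j jJ jI0].
have I0J' : I0 \subset J :\ j by rewrite finset.subsetD1 I0J.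
have J'k : #|J :\ j| = k by move: Jk; rewrite (cardsD1 j) jJ => -[].
have [delta] := IH _ J'k I0J'.
move=> /(good_lift_extend I0J')-/(_ j); rewrite finset.setD11 => /(_ isT).
rewrite finset.setD1K// Jk J'k subSn//.
by have := subset_leq_card I0J'; rewrite cardI0 J'k.
Qed.

End Climb.

Local Open Scope classical_set_scope.
Local Open Scope card_scope.

(** The inverse of a large threshold works as [eps]; the absolute value lets it serve both
    directions along [g]. *)
Lemma small_perturbation (R : realType) m (S : pred 'I_m) (f g : 'I_m -> R) :
  (forall i, S i -> 0 < f i) ->
  exists2 eps : R, 0 < eps & forall i, S i -> eps * `|g i| < f i.
Proof.
move=> f0; have [i|D D0 DP] := @eventually_forall_fin R 'I_m
  (fun i D => S i -> `|g i| < D * f i); last first.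
  exists D^-1; first by rewrite invr_gt0.
  by move=> i Si; rewrite ltr_pdivrMl//; exact: DP.
have [Si|] := boolP (S i); last by exists 0.
exists ((`|g i| + 1) / f i) => D leD _.
have fi := f0 i Si; rewrite ler_pdivrMr// in leD.
by rewrite (lt_le_trans _ leD)// ltrDl.
Qed.

(** * Faces of polyhedra *)

Section AffineDim.
Variables (R : realType) (e : nat).
Implicit Types (F V : set 'cV[R]_e) (W : {vspace 'cV[R]_e}) (p u v w : 'cV[R]_e).

Lemma direction_sub p q W W' :
  [set x | x - p \in W] `<=` [set x | x - q \in W'] -> (W <= W')%VS.
Proof.
move=> sub; apply/subvP => u uW.
have pq : p - q \in W' by apply: (sub p); rewrite /= subrr mem0v.
have uq : p + u - q \in W' by apply: (sub (p + u)); rewrite /= addrAC subrr add0r.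
have -> : u = (p + u - q) - (p - q) by rewrite opprB addrA subrK addrAC subrr add0r.
exact: memvB.
Qed.

Lemma affine_subspace_dim V k k' :
  affine_subspace k V -> affine_subspace k' V -> k = k'.
Proof.
move=> [p [W [<- ->]]] [q [W' [<- E]]]; congr (\dim _).
by apply: subv_anti; rewrite (@direction_sub p q) ?E// (@direction_sub q p)// E.
Qed.

Lemma affine_subspace_translate p W V x : V = [set x | x - p \in W] -> V x ->
  V = [set y | y - x \in W].
Proof.
move=> -> /= xW; apply/seteqP; split => y /= yW.
  have -> : y - x = (y - p) - (x - p) by rewrite opprB addrA subrK.
  exact: memvB.
have -> : y - p = (y - x) + (x - p) by rewrite addrA subrK.
exact: memvD.
Qed.

(** Each direction of [W] occurs in [F] up to a nonzero factor, so every affine subspace containing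
    [F] contains [p + W]. *)
Lemma affine_hull_spanned F p W : F p -> (forall x, F x -> x - p \in W) ->
  (forall u, u \in W -> exists2 eps : R, eps != 0 & F (p + eps *: u)) ->
  affine_hull F = [set x | x - p \in W].
Proof.
move=> Fp FW Weps; apply/seteqP; split.
  apply: smallest_sub => //; right; exists (\dim W); by exists p, W.
move=> x /= xW V /= [[V0|[k [q [W' [_ VE]]]]] FV]; first by have := FV _ Fp; rewrite V0.
have VE' := affine_subspace_translate VE (FV _ Fp).
rewrite VE' /=; have [eps eps0 Fe] := Weps _ xW.
have := FV _ Fe; rewrite VE' /= addrAC subrr add0r => H.
by rewrite -(scale1r (x - p)) -(mulVf eps0) -scalerA memvZ.
Qed.

Lemma has_dim_spanned F p W : F p -> (forall x, F x -> x - p \in W) ->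
  (forall u, u \in W -> exists2 eps : R, eps != 0 & F (p + eps *: u)) ->
  has_dim F (\dim W)%:Z.
Proof.
move=> Fp FW Weps; right; exists (\dim W); split=> //; exists p, W; split=> //.
exact: affine_hull_spanned.
Qed.

Lemma affine_hull0 : affine_hull (set0 : set 'cV[R]_e) = set0.
Proof.
apply/seteqP; split => //; apply: smallest_sub => //; by left.
Qed.

Lemma affine_hull_ge F : F `<=` affine_hull F.
Proof. exact: sub_gen_smallest. Qed.

Lemma affine_subspace_neq0 k V : affine_subspace k V -> V !=set0.
Proof. by move=> [p [W [_ ->]]]; exists p; rewrite /= subrr mem0v. Qed.

Lemma has_dim_uniq F q q' : has_dim F q -> has_dim F q' -> q = q'.
Proof.
move=> [[F0 ->]|[k [-> Fk]]] [[F0' ->]|[k' [-> Fk']]] //.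
- by have := affine_subspace_neq0 Fk'; rewrite F0 affine_hull0 => -[].
- by have := affine_subspace_neq0 Fk; rewrite F0' affine_hull0 => -[].
- by rewrite (affine_subspace_dim Fk Fk').
Qed.

End AffineDim.

(** * Tight rows, vertices and edges of a polyhedron *)

Section Polyhedra.
Variables (R : realType) (e m : nat) (B : 'M[R]_(m, e)) (c : 'cV[R]_m).
Local Notation Q := (polyhedron B c).
Implicit Types (v w x u : 'cV[R]_e) (K : {set 'I_m}).

Definition strictly_feasible x := forall i, (B *m x) i 0 < c i 0.

(** A point in the relative interior of the facet of row [i], certifying that the row is
    irredundant. *)
Definition irredundant_at i x :=
  (B *m x) i 0 = c i 0 /\ forall j, j != i -> (B *m x) j 0 < c j 0.

Definition tight_rows v : {set 'I_m} := [set i | (B *m v) i 0 == c i 0]%SET.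

Lemma tight_rowsP v K : reflect (forall i, i \in K -> (B *m v) i 0 = c i 0)
  (K \subset tight_rows v).
Proof.
by apply: (iffP fintype.subsetP) => H i iK; have := H i iK; rewrite inE => /eqP.
Qed.

Definition kernel_trivial K :=
  forall u, (forall i, i \in K -> (B *m u) i 0 = 0) -> u = 0.

Lemma kernel_trivial_card K : kernel_trivial K -> (e <= #|K|)%N.
Proof.
move=> Kt; pose M := \matrix_(i < #|K|, j < e) B (enum_val i) j.
have ME u i : (M *m u) i 0 = (B *m u) (enum_val i) 0.
  by rewrite !mxE; apply: eq_bigr => j _; rewrite mxE.
pose f : 'Hom('cV[R]_e, 'cV[R]_#|K|) := linfun (mulmx M).
have kf : lker f = 0%VS.
  apply/eqP; rewrite -subv0; apply/subvP => u; rewrite memv_ker lfunE /= => /eqP Mu.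
  rewrite memv0; apply/eqP/Kt => i iK.
  by rewrite -(enum_rankK_in iK iK) -ME Mu mxE.
have := limg_ker_dim f fullv; rewrite kf capv0 dimv0 add0n dimvf /dim /= muln1 => <-.
by rewrite (leq_trans (dimvS (subvf _)))// dimvf /dim /= muln1.
Qed.

(** The rows of [K] add up to a valid inequality, attained only where every summand is. *)
Lemma tight_face K : face Q (Q `&` [set x | K \subset tight_rows x]).
Proof.
pose a := \sum_(i in K) row i B; pose g := \sum_(i in K) c i 0.
have aE x : (a *m x) 0 0 = \sum_(i in K) (B *m x) i 0.
  rewrite mulmx_suml summxE; apply: eq_bigr => i _.
  by rewrite -row_mul mxE.
exists a, g; split.
  by move=> x Qx; rewrite aE; apply: ler_sum => i _; exact: Qx.
apply/seteqP; split => x /= [Qx xK]; split=> //.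
  by rewrite /hyperplane /= aE; apply: eq_bigr => i iK; exact: (tight_rowsP _ _ xK).
move: xK; rewrite /hyperplane /= aE => /eqP.
rewrite eq_le => /andP[_]; rewrite -subr_le0 -sumrB => le0.
apply/tight_rowsP => i iK; apply/esym/eqP; rewrite -subr_eq0.
have s0 : \sum_(i in K) (c i 0 - (B *m x) i 0) = 0.
  by apply/eqP; rewrite eq_le le0 sumr_ge0// => j _; rewrite subr_ge0.
by rewrite (psumr_eq0P _ s0)// => j _; rewrite subr_ge0.
Qed.

Lemma vertex_in v : vertex Q v -> Q v.
Proof.
by move=> [a [g [_ E]]]; have : [set v] v by []; rewrite E => -[].
Qed.

Lemma perturb_in v u : Q v ->
  (forall i, i \in tight_rows v -> (B *m u) i 0 = 0) ->
  exists2 eps : R, 0 < eps & Q (v + eps *: u) /\ Q (v - eps *: u).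
Proof.
move=> Qv ut.
have [i|eps eps0 epsP] := @small_perturbation R m (fun i => i \notin tight_rows v)
    (fun i => c i 0 - (B *m v) i 0) (fun i => (B *m u) i 0).
  by rewrite inE subr_gt0 lt_neqAle => ->; exact: Qv.
exists eps => //; split=> i.
  rewrite mulmx_addZ; have [it|it] := boolP (i \in tight_rows v).
    by rewrite ut// mulr0 addr0.
  have := epsP i it; have := ler_norm ((B *m u) i 0); nra.
rewrite mulmx_subZ; have [it|it] := boolP (i \in tight_rows v).
  by rewrite ut// mulr0 subr0.
have := epsP i it; have := ler_norm (- (B *m u) i 0); rewrite normrN; nra.
Qed.

(** A kernel vector can be followed both ways inside [Q], so the supporting functional is constant
    along it; as the face is one point, the vector is 0. *)
Lemma vertex_kernel v : vertex Q v -> kernel_trivial (tight_rows v).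
Proof.
move=> vv u ut; have [eps eps0 [Qp Qm]] := perturb_in (vertex_in vv) ut.
have [a [g [ag E]]] := vv.
have av : (a *m v) 0 0 = g by have : [set v] v by []; rewrite E => -[].
have := ag _ Qp; have := ag _ Qm; rewrite mulmx_subZ mulmx_addZ av => am ap.
have : (Q `&` hyperplane a g) (v + eps *: u).
  by split=> //; rewrite /hyperplane /= mulmx_addZ av; lra.
rewrite -E /= => /eqP; rewrite -subr_eq0 addrAC subrr add0r scaler_eq0.
by rewrite gt_eqF //= => /eqP.
Qed.

Lemma kernel_vertex v K : Q v -> K \subset tight_rows v -> kernel_trivial K ->
  vertex Q v.
Proof.
move=> Qv Kv Kt; rewrite /vertex (_ : [set v] = Q `&` [set x | K \subset tight_rows x]).
  exact: tight_face.
apply/seteqP; split => x /=; first by move=> ->.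
move=> [_ /tight_rowsP Kx]; apply/eqP; rewrite -subr_eq0 -(scale1r v); apply/eqP/Kt => i iK.
by rewrite mulmx_subZ Kx// (tight_rowsP _ _ Kv)//; lra.
Qed.

(** The rows of [K] cut out a face on the line through [v] and [w]; containing both points, it has
    dimension 1. *)
Lemma tight_adjacent v w K : vertex Q v -> vertex Q w -> v <> w ->
  K \subset tight_rows v -> K \subset tight_rows w ->
  (forall u, (forall i, i \in K -> (B *m u) i 0 = 0) -> exists t, u = t *: (w - v)) ->
  Defs.adjacent Q v w.
Proof.
move=> vv vw nvw Kv Kw Ker; split=> //.
exists (Q `&` [set x | K \subset tight_rows x]); split; last 2 first.
- by split=> //; exact: vertex_in.
- by split=> //; exact: vertex_in.
split; first exact: tight_face.
have wv : w - v != 0 by rewrite subr_eq0; apply/eqP => /esym.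
rewrite (_ : 1 = (\dim <[w - v]>)%:Z); last by rewrite dim_vline wv.
apply: (@has_dim_spanned _ _ _ v).
- by split=> //; exact: vertex_in.
- move=> x [_ /= Kx]; apply/vlineP; apply: Ker => i iK.
  rewrite -(scale1r v) mulmx_subZ (tight_rowsP _ _ Kx)// (tight_rowsP _ _ Kv)//; lra.
(* The factor must be nonzero: any one serves the zero vector, otherwise [t^-1] leads to [w]. *)
- move=> u /vlineP[t ->]; have [->|t0] := eqVneq t 0.
    exists 1; rewrite ?oner_eq0// scale0r scaler0 addr0.
    by split=> //; exact: vertex_in.
  exists t^-1; rewrite ?invr_eq0// scalerA mulVf// scale1r addrC subrK.
  by split=> //; exact: vertex_in.
Qed.

Lemma adjacent_sym v w : Defs.adjacent Q v w -> Defs.adjacent Q w v.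
Proof.
move=> [vv vw nvw [F [? ? ?]]]; split=> //; first by move=> /esym.
by exists F.
Qed.

End Polyhedra.

Lemma card_finset (T : finType) (K : {set T}) : [set` K] #= `I_#|K|.
Proof.
have -> : [set` K] = enum_val @` [set: 'I_#|K|].
  apply/seteqP; split => x /=; last by move=> [i _ <-]; exact: enum_valP.
  by move=> xK; exists (enum_rank_in xK x) => //; rewrite enum_rankK_in.
apply: (card_eq_trans (inj_card_eq _)); first by move=> ? ? _ _; exact: enum_val_inj.
by rewrite card_eq_sym card_II.
Qed.

(** * Facets of a full-dimensional polyhedron with irredundant rows *)

Section Facets.
Variables (R : realType) (e m : nat) (B : 'M[R]_(m, e.+1)) (c : 'cV[R]_m).
Local Notation Q := (polyhedron B c).
Implicit Types (v w x u : 'cV[R]_e.+1) (F : set 'cV[R]_e.+1).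

Hypothesis interior_pt : exists x, strictly_feasible B c x.
Hypothesis irredundant_pt : forall i, exists x, irredundant_at B c i x.

Lemma strictly_feasible_in x : strictly_feasible B c x -> Q x.
Proof. by move=> sx i; exact/ltW. Qed.

Lemma strictly_feasible_perturb x u : strictly_feasible B c x ->
  exists2 eps : R, 0 < eps & Q (x + eps *: u) /\ Q (x - eps *: u).
Proof.
move=> sx; apply: perturb_in; first exact: strictly_feasible_in.
by move=> i; rewrite inE lt_eqF.
Qed.

Lemma strictly_feasible_has_dim F x : strictly_feasible B c x -> F x -> Q `<=` F ->
  has_dim F e.+1%:Z.
Proof.
move=> sx Fx QF; have -> : e.+1%:Z = (\dim (fullv : {vspace 'cV[R]_e.+1}))%:Z.
  by rewrite dimvf /dim /= muln1.
apply: (@has_dim_spanned _ _ _ x) => // [y _|u _]; first exact: memvf.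
have [eps eps0 [Qp _]] := strictly_feasible_perturb u sx.
by exists eps; [rewrite gt_eqF|exact: QF].
Qed.

Lemma polyhedron_has_dim : has_dim Q e.+1%:Z.
Proof.
by have [x sx] := interior_pt;
  apply: (strictly_feasible_has_dim sx) => //; exact: strictly_feasible_in.
Qed.

Definition row_kernel i : {vspace 'cV[R]_e.+1} := lker (linfun (mulmx (row i B))).

Lemma mem_row_kernel i u : (u \in row_kernel i) = ((B *m u) i 0 == 0).
Proof.
rewrite memv_ker lfunE /= -row_mul; apply/eqP/eqP => [/matrixP/(_ 0 0)|H].
  by rewrite !mxE.
by apply/matrixP => a b; rewrite !ord1 mxE H mxE.
Qed.

(** The row is nonzero, as it takes different values at an interior point and at a facet point;
    rank-nullity applies. *)
Lemma row_kernel_dim i : \dim (row_kernel i) = e.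
Proof.
have := limg_ker_dim (linfun (mulmx (row i B)) : 'Hom('cV[R]_e.+1, 'cV[R]_1)) fullv.
rewrite capfv -/(row_kernel i) dimvf /dim /= muln1.
suff -> : \dim (limg (linfun (mulmx (row i B)) : 'Hom('cV[R]_e.+1, 'cV[R]_1))) = 1%N.
  by rewrite addn1 => -[].
apply/eqP; rewrite eqn_leq; apply/andP; split.
  by rewrite (leq_trans (dimvS (subvf _)))// dimvf /dim /= muln1.
rewrite lt0n dimv_eq0; apply/negP => /eqP lim0.
have [x sx] := interior_pt; have [p [pi _]] := irredundant_pt i.
have : p - x \in row_kernel i.
  by rewrite /row_kernel memv_ker -memv0 -lim0 memv_img ?memvf.
rewrite mem_row_kernel -(scale1r x) mulmx_subZ pi mul1r subr_eq0.
by rewrite gt_eqF.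
Qed.

Definition row_face i := Q `&` [set x | i \in tight_rows B c x].

Lemma row_face_dim i : has_dim (row_face i) e%:Z.
Proof.
have [p [pi pj]] := irredundant_pt i.
have Qp : Q p by move=> j; have [->|/pj/ltW//] := eqVneq j i; rewrite pi.
have tp j : j \in tight_rows B c p -> j = i.
  by rewrite inE; apply: contraTeq => /pj; rewrite lt_neqAle => /andP[].
have -> : e%:Z = (\dim (row_kernel i))%:Z by rewrite row_kernel_dim.
apply: (@has_dim_spanned _ _ _ p).
- by split=> //=; rewrite inE pi.
- move=> x [_ /=]; rewrite inE => /eqP xi.
  by rewrite mem_row_kernel -(scale1r p) mulmx_subZ xi pi mul1r subrr.
- move=> u; rewrite mem_row_kernel => /eqP ui.
  have [|eps eps0 [Qe _]] := @perturb_in _ _ _ B c p u Qp; first by move=> j /tp->.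
  exists eps; first by rewrite gt_eqF.
  by split=> //=; rewrite inE mulmx_addZ ui pi mulr0 addr0.
Qed.

Lemma row_face_facet i : facet Q (row_face i).
Proof.
split.
  have := tight_face B c [set i]%SET; rewrite /row_face; congr face; congr (_ `&` _).
  by apply/seteqP; split => x /=; rewrite finset.sub1set.
exists e.+1%:Z; split; first exact: polyhedron_has_dim.
rewrite (_ : e.+1%:Z - 1 = e%:Z); first exact: row_face_dim.
by rewrite -addn1 PoszD addrK.
Qed.

Lemma row_face_inj : injective row_face.
Proof.
move=> i j ij; have [p [pi pj]] := irredundant_pt i.
have : row_face i p.
  split; last by rewrite /= inE pi.
  by move=> k; have [->|/pj/ltW//] := eqVneq k i; rewrite pi.
rewrite ij => -[_ /=]; rewrite inE; apply: contraTeq; rewrite eq_sym => /pj.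
by rewrite lt_neqAle => /andP[].
Qed.

(** Otherwise each row is strict at some point of [F]. Averaging gives a strictly feasible point of
    [F], so the functional supporting [F] is constant on [Q] and [F] is full-dimensional. *)
Lemma face_in_row F : face Q F -> F !=set0 -> ~ has_dim F e.+1%:Z ->
  exists i, F `<=` row_face i.
Proof.
move=> [a [g [ag FE]]] [x0 Fx0] nF; apply: contrapT => /forallNP noi; apply: nF.
have /fin_all_exists[f fP] : forall i, exists x, F x /\ (B *m x) i 0 < c i 0.
  move=> i; apply: contrapT => /forallNP no; apply: (noi i) => x Fx.
  have Qx : Q x by move: Fx; rewrite FE => -[].
  split=> //=; rewrite inE eq_le Qx leNgt; apply/negP => xi.
  by apply: (no x).
have FQ x : F x -> Q x by rewrite FE => -[].
have Fa x : F x -> (a *m x) 0 0 = g by rewrite FE => -[].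
have m1 : 0 < (m.+1%:R : R) by rewrite ltr0n.
(* Including [x0] in the average keeps it meaningful when there are no rows. *)
pose x := m.+1%:R^-1 *: (x0 + \sum_i f i).
have sumE k (M : 'M[R]_(k, e.+1)) j : (M *m x) j 0 =
    m.+1%:R^-1 * ((M *m x0) j 0 + \sum_i (M *m f i) j 0).
  by rewrite -scalemxAr mulmxDr mulmx_sumr !mxE summxE.
have cst (t : R) : m.+1%:R^-1 * (t + \sum_(i < m) t) = t.
  rewrite sumr_const card_ord -{1}(mulr1n t) -mulrnDr add1n -(mulr_natl t).
  by rewrite mulKf// gt_eqF.
have sx : strictly_feasible B c x.
  move=> i; rewrite sumE -[ltRHS]cst ltr_pM2l ?invr_gt0//.
  apply: ler_ltD; first exact: FQ.
  rewrite [ltLHS](bigD1 i)//= [ltRHS](bigD1 i)//=; apply: ltr_leD; first by have [] := fP i.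
  by apply: ler_sum => j _; apply: FQ; have [] := fP j.
have ax : (a *m x) 0 0 = g.
  rewrite sumE Fa// -[RHS]cst; congr (_ * (_ + _)); apply: eq_bigr => i _.
  by rewrite Fa//; have [] := fP i.
have Fx : F x by rewrite FE; split=> //; exact: strictly_feasible_in.
apply: (strictly_feasible_has_dim sx Fx) => y Qy; rewrite FE; split=> //.
have [eps eps0 [Qp Qm]] := strictly_feasible_perturb (y - 1 *: x) sx.
have := ag _ Qp; have := ag _ Qm.
by rewrite mulmx_addZ mulmx_subZ mulmx_subZ ax /hyperplane /=; nra.
Qed.

(** [F] lies in a row face of the same dimension, so its affine hull contains that row face. The
    functional defining [F] is constant on this hull, hence the row face lies in [F]. *)
Lemma facet_row_face F : facet Q F -> exists i, F = row_face i.
Proof.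
move=> [fF [q [Qq Fq]]].
have qE : q - 1 = e%:Z.
  by rewrite (has_dim_uniq Qq polyhedron_has_dim) -addn1 PoszD addrK.
rewrite {}qE in Fq.
(* The empty set has dimension -1, which differs from [e]. *)
have F0 : F !=set0.
  apply/set0P/eqP => F0; have := has_dim_uniq Fq (or_introl (conj F0 erefl)).
  by [].
have [|i Fi] := face_in_row fF F0.
  by move=> /(has_dim_uniq Fq) [] /n_Sn.
exists i; apply/seteqP; split=> // x [Qx xi].
have [y Fy] := F0.
case: Fq => [[_]//|[k [[<-] aF]]].
have [p [W [We HE]]] := aF.
have HE' := affine_subspace_translate HE (affine_hull_ge Fy).
have yi := (Fi _ Fy).2; rewrite /= !inE in xi yi.
have WE : W = row_kernel i.
  apply/eqP; rewrite -(dimv_leqif_eq _) ?We ?row_kernel_dim//.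
  apply: (@direction_sub _ _ y y); rewrite -HE'.
  apply: smallest_sub.
    by right; exists (\dim (row_kernel i)), y, (row_kernel i).
  move=> z /Fi[_] /=; rewrite inE => /eqP zi.
  by rewrite mem_row_kernel -(scale1r y) mulmx_subZ zi (eqP yi) mul1r subrr.
have xF : affine_hull F x.
  by rewrite HE' /= WE mem_row_kernel -(scale1r y) mulmx_subZ (eqP yi) (eqP xi) mul1r subrr.
have [a [g [ag FE]]] := fF.
rewrite FE; split=> //.
have Fa z : F z -> (a *m z) 0 0 = g by rewrite FE => -[].
pose Wa : {vspace 'cV[R]_e.+1} := lker (linfun (mulmx a)).
have WaE u : u \in Wa -> (a *m u) 0 0 = 0.
  by rewrite memv_ker lfunE /= => /eqP->; rewrite mxE.
have aW u : (a *m u) 0 0 = 0 -> u \in Wa.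
  move=> H; rewrite memv_ker lfunE /=; apply/eqP/matrixP => j1 j2.
  by rewrite !ord1 H mxE.
have : affine_hull F `<=` [set z | z - y \in Wa].
  apply: smallest_sub; first by right; exists (\dim Wa), y, Wa.
  by move=> z Fz; apply: aW; rewrite -(scale1r y) mulmx_subZ !Fa// mul1r subrr.
move=> /(_ _ xF) /= /WaE; rewrite -(scale1r y) mulmx_subZ (Fa _ Fy) mul1r => /eqP.
by rewrite subr_eq0 => /eqP.
Qed.

Lemma card_facets : [set F | facet Q F] #= `I_m.
Proof.
have -> : [set F | facet Q F] = row_face @` [set: 'I_m].
  apply/seteqP; split => F /=; first by move=> /facet_row_face[i ->]; exists i.
  by move=> [i _ <-]; exact: row_face_facet.
apply: (card_eq_trans (inj_card_eq _)); first by move=> ? ? _ _; exact: row_face_inj.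
by rewrite card_eq_sym card_II.
Qed.

Lemma card_facets_at v : Q v ->
  [set F | facet Q F /\ F v] #= `I_#|tight_rows B c v|.
Proof.
move=> Qv; have -> : [set F | facet Q F /\ F v] = row_face @` [set` tight_rows B c v].
  apply/seteqP; split => F /=.
    by move=> [/facet_row_face[i ->] [_ vi]]; exists i.
  by move=> [i iv <-]; split; [exact: row_face_facet|split].
apply: (card_eq_trans (inj_card_eq _)); first by move=> ? ? _ _; exact: row_face_inj.
exact: card_finset.
Qed.

End Facets.


(** * Simplices circumscribed to bounded polyhedra *)

Lemma continuous_sum (R : realType) (T : topologicalType) n (F : 'I_n -> T -> R) :
  (forall i, continuous (F i)) -> continuous (fun x => \sum_i F i x).
Proof.
move=> cF; apply: (@continuous_big R 'I_n +%R 0 xpredT _ T (index_enum _) F) => //.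
exact: (@add_continuous R).
Qed.

Lemma compact_simplex (R : realType) n :
  compact [set l : 'rV[R]_n | (forall i, 0 <= l 0 i) /\ \sum_i l 0 i = 1].
Proof.
apply: (@subclosed_compact _ _ [set l : 'rV[R]_n | forall i, (`[0 : R, 1 : R]%classic : set R) (l ord0 i)]).
- have -> : [set l : 'rV[R]_n | (forall i, 0 <= l 0 i) /\ \sum_i l 0 i = 1] =
    (\bigcap_(i in [set: 'I_n]) ((fun l : 'rV[R]_n => l 0 i) @^-1` [set x | 0 <= x])) `&`
    ((fun l : 'rV[R]_n => \sum_i l 0 i) @^-1` [set 1]).
    by apply/seteqP; split => l /= [l0 l1]; split=> // i; [move=> _; exact: l0|exact: l0].
  apply: closedI.
    apply: closed_bigI => i _; apply: closed_comp; last exact: closed_ge.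
    by move=> l _; exact: coord_continuous.
  apply: closed_comp; last exact: closed_eq.
  suff c : continuous (fun l : 'rV[R]_n => \sum_i l 0 i) by move=> l _; exact: c.
  by apply: (@continuous_sum R _ n (fun i (l : 'rV[R]_n) => l 0 i)) => i; exact: coord_continuous.
- by apply: (@rV_compact _ _ (fun=> `[0 : R, 1 : R]%classic)) => i; exact: segment_compact.
- move=> l /= [l0 l1] i; rewrite /= in_itv /= l0 -l1 (bigD1 i)//= lerDl.
  exact: sumr_ge0.
Qed.

(* The vector of least norm in the convex hull of the rows is [0]; otherwise its
   opposite would be a strict descent direction for every row. *)
Lemma gordan (R : realType) n d (A : 'M[R]_(n, d)) :
  (forall u : 'cV_d, exists i, 0 <= (A *m u) i 0) ->
  exists l : 'rV[R]_n, [/\ forall i, 0 <= l 0 i, l != 0 & l *m A = 0].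
Proof.
move=> Au.
pose S := [set l : 'rV[R]_n | (forall i, 0 <= l 0 i) /\ \sum_i l 0 i = 1].
have deltaS i : S (delta_mx 0 i).
  split=> [j|]; first by rewrite mxE ler0n.
  by rewrite (bigD1 i)//= big1 ?mxE ?eqxx ?addr0// => j /negbTE ji; rewrite mxE ji andbF.
pose dot (p q : 'rV[R]_d) := \sum_j p 0 j * q 0 j.
pose f (l : 'rV[R]_n) : R := dot (l *m A) (l *m A).
have dot_ge0 p : 0 <= dot p p by apply: sumr_ge0 => j _; rewrite -expr2 sqr_ge0.
have dotD p q t : dot (p + t *: q) (p + t *: q) =
    dot p p + 2 * t * dot p q + t ^+ 2 * dot q q.
  rewrite /dot !mulr_sumr -!big_split /=; apply: eq_bigr => j _; rewrite !mxE; ring.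
have S0 : S !=set0 by have [i _] := Au 0; exists (delta_mx 0 i).
have fc : continuous f.
  apply: (@continuous_sum R _ d (fun j (l : 'rV[R]_n) => (l *m A) 0 j * (l *m A) 0 j)) => j.
  suff c : continuous (fun l : 'rV[R]_n => (l *m A) 0 j).
    by move=> l; apply: continuousM; exact: c.
  rewrite (_ : (fun l => _) = (fun l : 'rV[R]_n => \sum_k l 0 k * A k j)); last first.
    by apply/funext => l; rewrite mxE.
  apply: (@continuous_sum R _ n (fun k (l : 'rV[R]_n) => l 0 k * A k j)) => k l; apply: continuousM; first exact: coord_continuous.
  exact: cst_continuous.
have [l lS lmin] := EVT_min_rV S0 (@compact_simplex R n) (continuous_subspaceT fc).
move: lS; rewrite inE => -[l0 l1].
exists l; split=> //.
  apply/eqP => lz; move: l1; rewrite big1 => [/eqP|i _]; last by rewrite lz mxE.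
  by rewrite eq_sym oner_eq0.
set q := l *m A.
suff q0 : dot q q = 0.
  apply/rowP => j; rewrite [RHS]mxE.
  have /psumr_eq0P H : \sum_k q 0 k ^+ 2 = 0.
    by rewrite -[RHS]q0; apply: eq_bigr => k _; rewrite expr2.
  by apply/eqP; rewrite -(sqrf_eq0 (q 0 j)) H// => k _; exact: sqr_ge0.
apply/eqP; rewrite eq_le dot_ge0 andbT leNgt; apply/negP => q0.
(* Testing the direction [- q] yields a row [i] whose inner product with [q] is at most 0. *)
have [i] := Au (- q^T).
have -> : (A *m - q^T) i 0 = - dot q (row i A).
  rewrite mulmxN mxE mxE; congr (- _); apply: eq_bigr => j _.
  by rewrite !mxE mulrC.
rewrite oppr_ge0 => qi.
(* Moving [l] by [t] towards the [i]-th unit vector adds [2 * t * dot q r + t ^+ 2 * M] to the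
   squared norm, and [dot q r <= - dot q q]. This [t] lies in the unit interval and makes
   [t * M < dot q q], so the norm drops. *)
set r := row i A - q; pose M := dot r r; pose t := dot q q / (dot q q + M).
have M0 : 0 <= M by exact: dot_ge0.
have qM : 0 < dot q q + M by rewrite ltr_wpDr.
have t0 : 0 < t by rewrite divr_gt0.
have t1 : t <= 1 by rewrite ler_pdivrMr// mul1r lerDl.
have tE : t * (dot q q + M) = dot q q by rewrite divfK// gt_eqF.
have : f l <= f (l + t *: (delta_mx 0 i - l)).
  apply: lmin; rewrite inE; split.
    move=> k; rewrite !mxE; have := l0 k; have : 0 <= (((0:'I_1) == 0) && (k == i))%:R :> R by [].
    set x := _%:R; move=> x0 lk.
    have -> : l 0 k + t * (x - l 0 k) = (1 - t) * l 0 k + t * x by ring.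
    by rewrite addr_ge0// mulr_ge0// ?subr_ge0// ltW.
  transitivity (\sum_k l 0 k + t * (\sum_k (delta_mx 0 i : 'rV[R]_n) 0 k - \sum_k l 0 k)).
    rewrite -sumrB mulr_sumr -big_split /=; apply: eq_bigr => k _.
    by rewrite !mxE.
  by rewrite l1 (deltaS i).2 subrr mulr0 addr0.
rewrite /f mulmxDl -scalemxAl mulmxBl -rowE -/q -/r dotD -/M.
have -> : dot q r = dot q (row i A) - dot q q.
  by rewrite /dot -sumrB; apply: eq_bigr => j _; rewrite !mxE; ring.
nra.
Qed.

(** The matrix [P] selects the rows of [T]; they are too many for rank [d], and their dependency is
    extended by zero. *)
Lemma row_dependency (R : realType) n d (A : 'M[R]_(n, d)) (T : {set 'I_n}) :
  (d < #|T|)%N -> exists l : 'rV[R]_n,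
    [/\ l != 0, forall i, i \notin T -> l 0 i = 0 & l *m A = 0].
Proof.
move=> dT; pose P : 'M[R]_(#|T|, n) := \matrix_(k, i) (enum_val k == i)%:R.
have : kermx (P *m A) != 0.
  rewrite kermx_eq0 /row_free neq_ltn; apply/orP; left.
  exact: leq_ltn_trans (rank_leq_col _) dT.
move=> /rowV0Pn[v /sub_kermxP vM v0]; exists (v *m P); split.
- apply: contra_neq v0 => /rowP vP; apply/rowP => k.
  have := vP (enum_val k); rewrite !mxE (bigD1 k)//= big1 ?mxE ?eqxx ?mulr1 ?addr0//.
  by move=> j jk; rewrite mxE (inj_eq enum_val_inj) (negbTE jk) mulr0.
- move=> i iT; rewrite mxE big1// => k _; rewrite mxE.
  by case: eqP => [ki|_]; rewrite ?mulr0//; move: iT; rewrite -ki enum_valP.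
- by rewrite -mulmxA.
Qed.

(* A nonnegative row dependency of minimal support uses exactly [d + 1] rows. *)
Lemma simplex_rows (R : realType) n d (A : 'M[R]_(n, d)) beta :
  generic_system A beta -> (forall u : 'cV_d, exists i, 0 <= (A *m u) i 0) ->
  exists I0 : {set 'I_n}, #|I0| = d.+1 /\
    forall u : 'cV_d, (forall i, i \in I0 -> (A *m u) i 0 <= 0) -> u = 0.
Proof.
move=> genA Au; pose dep (l : 'rV[R]_n) := [/\ forall i, 0 <= l 0 i, l != 0 & l *m A = 0].
pose supp (l : 'rV[R]_n) : {set 'I_n} := [set i | l 0 i != 0]%SET.
have ex : exists k, `[< exists2 l, dep l & #|supp l| = k >].
  by have [l dl] := gordan Au; exists #|supp l|; apply/asboolP; exists l.
have [k /asboolP[l [l0 ln lA] lk] kmin] := ex_minnP ex.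
have sumE (u : 'cV_d) : \sum_(i in supp l) l 0 i * (A *m u) i 0 = 0.
  transitivity ((l *m A *m u) 0 0); last by rewrite lA mul0mx mxE.
  rewrite -mulmxA mxE [RHS](bigID (mem (supp l)))/= [X in _ + X]big1 ?addr0//.
  by move=> i; rewrite inE negbK => /eqP->; rewrite mul0r.
have lp i : i \in supp l -> 0 < l 0 i by rewrite inE lt0r l0 andbT.
(* On at most [d] rows some [u] takes the value 1 everywhere, and the dependency would make the
   nonnegative coefficients sum to 0. *)
have dk : (d < #|supp l|)%N.
  rewrite ltnNge; apply/negP => kd.
  have [u u1] := generic_solve genA kd (fun=> 1).
  have /psumr_eq0P H : \sum_(i in supp l) l 0 i = 0.
    by rewrite -[RHS](sumE u); apply: eq_bigr => i il; rewrite u1// mulr1.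
  move/eqP: ln; apply; apply/rowP => i; rewrite mxE.
  have [il|] := boolP (i \in supp l); first by rewrite H.
  by rewrite inE negbK => /eqP.
exists (supp l); split; last first.
  move=> u ul; apply: (generic_inj_ge genA (ltnW dk)) => i il.
  have /psumr_eq0P H : \sum_(i in supp l) - (l 0 i * (A *m u) i 0) = 0.
    by rewrite sumrN sumE oppr0.
  have /eqP : - (l 0 i * (A *m u) i 0) = 0.
    by apply: H => // j jl; rewrite oppr_ge0 pmulr_rle0 ?lp// ul.
  by rewrite oppr_eq0 mulf_eq0 (gt_eqF (lp _ il)) => /eqP.
apply/eqP; rewrite eqn_leq dk andbT leqNgt; apply/negP => dk2.
(* With more than [d + 1] rows a second dependency avoids [i0]. Subtracting a multiple of it from
   [l] kills a coefficient while that of [i0] stays, which contradicts minimality. *)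
have /card_gt0P[i0 i0l] : (0 < #|supp l|)%N by exact: leq_trans dk2.
have [|m [mn mT mA]] := @row_dependency _ _ _ A (supp l :\ i0)%SET.
  by move: dk2; rewrite (cardsD1 i0) i0l.
wlog [i1 m1] : m mn mT mA / exists i, 0 < m 0 i.
  move=> wl; have [?|no] := pselect (exists i, 0 < m 0 i); first exact: (wl m).
  apply: (wl (- m)); rewrite ?oppr_eq0 ?mulNmx ?mA ?oppr0//.
    by move=> i /mT; rewrite mxE => ->; rewrite oppr0.
  have /rV0Pn[i mi] := mn; exists i; rewrite mxE oppr_gt0 lt_neqAle mi leNgt.
  by apply/negP => mi0; apply: no; exists i.
have [|H|[t [i [t0 _ mi li tP]]]] := @ray_shooting R n [set: 'I_n]%SET (fun i => l 0 i) (fun i => m 0 i).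
- by move=> i _; exact: l0.
- by have := H i1; rewrite inE leNgt m1 => /(_ isT).
have : (k <= #|supp (l - t *: m)%R|)%N.
  apply: kmin; apply/asboolP; exists (l - t *: m) => //; split.
  - by move=> j; rewrite !mxE subr_ge0 tP// inE.
  - apply/eqP => /rowP/(_ i0); rewrite !mxE mT ?mulr0 ?subr0; last by rewrite !inE eqxx.
    by move/eqP; apply/negP; move: i0l; rewrite inE.
  - by rewrite mulmxBl -scalemxAl lA mA scaler0 subr0.
rewrite -lk leqNgt => /negP; apply.
apply: proper_card; apply/properP; split.
  apply/fintype.subsetP => j; rewrite !inE; apply: contraNN => /eqP lj.
  by rewrite !mxE mT ?lj ?mulr0 ?subr0// !inE lj eqxx andbF.
exists i; last by rewrite inE !mxE li subrr eqxx.
apply: contraTT mi => il; rewrite mT ?ltxx// in_setD1 negb_and.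
by rewrite il orbT.
Qed.

(** * Rays in bounded sets, and a diameter bound from paths to one point *)

Lemma bounded_ray (R : realType) d (P : set 'cV[R]_d) x u :
  bounded_set P -> (forall t : R, 0 <= t -> P (x + t *: u)) -> u = 0.
Proof.
move=> [M' [_ /(_ (M' + 1) (ltr_pwDr ltr01 (lexx M')))]].
move: (M' + 1) => M PM ray; apply/eqP; rewrite -normr_eq0; apply/negPn/negP => u0.
have up : 0 < `|u| by rewrite lt0r u0 normr_ge0.
have M0 : 0 <= M.
  by rewrite (le_trans (normr_ge0 x))//; have := PM _ (ray 0 (lexx _)); rewrite /= scale0r addr0.
pose t := (`|x| + M + 1) / `|u|.
have t0 : 0 <= t by rewrite divr_ge0// !addr_ge0.
have := PM _ (ray t t0); rewrite /= => leM.
have : `|t *: u| <= `|x + t *: u| + `|x|.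
  by rewrite -{1}(addKr x (t *: u)) addrC (le_trans (ler_normD _ _))// normrN.
rewrite normrZ (ger0_norm t0) divfK//; lra.
Qed.

(** A path from [v] to [o] is followed by the reversal of a path from [w] to [o]; the diameter is
    the least bound that works. *)
Lemma diameter_from_apex (R : realType) d (P : set 'cV[R]_d) o N :
  (forall v w, Defs.adjacent P v w -> Defs.adjacent P w v) ->
  (forall v, vertex P v -> exists p : seq 'cV[R]_d,
    [/\ path (fun x y => `[< Defs.adjacent P x y >]) v p, last v p = o & (size p <= N)%N]) ->
  exists delta, is_diameter P delta /\ (delta <= 2 * N)%N.
Proof.
move=> symP toO.
have cw : connected_within P (2 * N).
  move=> v w vv vw; have [p [pp pl ps]] := toO v vv; have [q [qp ql qs]] := toO w vw.
  exists (p ++ rev (belast w q)); split.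
  - rewrite cat_path pp pl -ql rev_path /=.
    by apply: sub_path qp => x y /asboolP/symP xy; exact/asboolP.
  - rewrite last_cat pl -ql; case: (q) => //= a s.
    by rewrite rev_cons last_rcons.
  - by rewrite size_cat size_rev size_belast mul2n -addnn leq_add.
have ex : exists k, `[< connected_within P k >] by exists (2 * N)%N; exact/asboolP.
have [k /asboolP ck kmin] := ex_minnP ex.
exists k; split; last by apply: kmin; exact/asboolP.
by split=> // k' ck'; apply: kmin; exact/asboolP.
Qed.


(** * The rock extension *)

Section RockExtension.
Variables (R : realType) (n d r : nat) (A : 'M[R]_(n, d)) (b : 'cV[R]_n).
Variables (x0 : 'cV[R]_d) (I0 : {set 'I_n}) (delta : 'I_n -> R) (eta : R).

(** The right-hand side of the system translated so that [x0] becomes the origin. *)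
Definition slack i := b i 0 - (A *m x0) i 0.

Hypothesis nE : n = (d.+1 + r)%N.
Hypothesis slack_gt0 : forall i, 0 < slack i.
Hypothesis genA : generic_system A slack.
Hypothesis cardI0 : #|I0| = d.+1.
Hypothesis simplexI0 : forall u : 'cV_d, (forall i, i \in I0 -> (A *m u) i 0 <= 0) -> u = 0.
Hypothesis bndP : bounded_set (polyhedron A b).
(** The second alternative, a single row, serves the point in dimension 0. *)
Hypothesis irrA : forall i, (exists x, irredundant_at A b i x) \/ (forall j, j = i).
Hypothesis good : good_lift A slack I0 [set: 'I_n]%SET delta r.
Hypothesis eta_gt0 : 0 < eta.
Hypothesis eta_big : forall i, delta i < eta * slack i.

Let a i := eta * slack i - delta i.

Lemma lift_coef_gt0 i : 0 < a i.
Proof. by rewrite subr_gt0. Qed.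

(** The rows [- z <= 0] and [a i * z + A_i x <= b_i]. The block form relies on [1 + n] computing to
    [n.+1]. *)
Definition rock_mx : 'M[R]_(n.+1, d.+1) :=
  block_mx (-1)%:M 0 (\col_i a i) A : 'M[R]_(1 + n, 1 + d).
Definition rock_rhs : 'cV[R]_n.+1 := col_mx 0 b : 'cV_(1 + n).
Local Notation B := rock_mx.
Local Notation c := rock_rhs.
Local Notation Q := (polyhedron rock_mx rock_rhs).

Definition rock_vec (z : R) (x : 'cV[R]_d) : 'cV[R]_d.+1 := col_mx z%:M x : 'cV_(1 + d).
Definition rock_pt z w := rock_vec z (x0 + w).
Local Notation base := (@lshift 1 n ord0 : 'I_n.+1).
Local Notation lifted i := (@rshift 1 n i : 'I_n.+1).

Lemma rock_vec_top z x : rock_vec z x (@lshift 1 d ord0) 0 = z.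
Proof. by rewrite /rock_vec [LHS]col_mxEu mxE mulr1n. Qed.

Lemma rock_vec_bot z x (j : 'I_d) : rock_vec z x (@rshift 1 d j) 0 = x j 0.
Proof. by rewrite /rock_vec [LHS]col_mxEd. Qed.

Lemma rock_vec_ex v : exists z x, v = rock_vec z x.
Proof.
exists ((usubmx (v : 'cV_(1 + d))) 0 0), (dsubmx (v : 'cV_(1 + d))).
by rewrite /rock_vec -mx11_scalar vsubmxK.
Qed.

Lemma rock_pt_ex v : exists z w, v = rock_pt z w.
Proof.
have [z [x ->]] := rock_vec_ex v; exists z, (x - x0).
by rewrite /rock_pt addrC subrK.
Qed.

Lemma rock_pt_sub z w z' w' : rock_pt z w - rock_pt z' w' = rock_vec (z - z') (w - w').
Proof.
rewrite /rock_pt /rock_vec -[LHS]/((col_mx _ _ : 'cV[R]_(1 + d)) - col_mx _ _).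
rewrite opp_col_mx add_col_mx -raddfN -raddfD /=.
by rewrite opprD addrACA subrr add0r.
Qed.

Lemma rock_vecZ t z x : t *: rock_vec z x = rock_vec (t * z) (t *: x).
Proof.
rewrite /rock_vec -[LHS]/(t *: (col_mx _ _ : 'cV[R]_(1 + d))).
by rewrite scale_col_mx scale_scalar_mx.
Qed.

Lemma rock_vec0 : rock_vec 0 0 = 0.
Proof. by rewrite /rock_vec raddf0 col_mx0. Qed.

Lemma rock_pt_inj z w z' w' : rock_pt z w = rock_pt z' w' -> z = z' /\ w = w'.
Proof.
move=> /(@eq_col_mx _ 1 d 1)[/(congr1 (fun M : 'M[R]_1 => M 0 0))].
by rewrite !mxE !mulr1n => -> /addrI.
Qed.

Lemma rock_base z x : (B *m rock_vec z x) base 0 = - z.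
Proof.
rewrite /rock_mx /rock_vec (@mul_block_col R 1 n 1 d 1) mul0mx addr0 [LHS]col_mxEu.
by rewrite -scalar_mxM !mxE mulr1n mulN1r.
Qed.

Lemma rock_lifted z x i : (B *m rock_vec z x) (lifted i) 0 = a i * z + (A *m x) i 0.
Proof.
rewrite /rock_mx /rock_vec (@mul_block_col R 1 n 1 d 1) [LHS]col_mxEd.
by rewrite mul_mx_scalar !mxE; congr (_ + _); rewrite mulrC.
Qed.

Lemma rock_rhs_base : c base 0 = 0.
Proof. by rewrite /rock_rhs [LHS]col_mxEu mxE. Qed.

Lemma rock_rhs_lifted i : c (lifted i) 0 = b i 0.
Proof. by rewrite /rock_rhs [LHS]col_mxEd. Qed.

Lemma rock_rows (S : 'I_n.+1 -> Prop) : S base -> (forall i, S (lifted i)) -> forall k, S k.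
Proof. by move=> S0 S1 k; have [j ->|j ->] := @split_ordP 1 n k; rewrite ?ord1. Qed.

Lemma rock_ptP z w :
  Q (rock_pt z w) <-> 0 <= z /\ forall i, (A *m w) i 0 <= slack i - a i * z.
Proof.
have E i : ((B *m rock_pt z w) (lifted i) 0 <= c (lifted i) 0) =
    ((A *m w) i 0 <= slack i - a i * z).
  rewrite rock_lifted rock_rhs_lifted mulmxDr mxE /slack.
  by apply/idP/idP; lra.
have E0 : ((B *m rock_pt z w) base 0 <= c base 0) = (0 <= z).
  by rewrite rock_base rock_rhs_base oppr_le0.
split=> [Qz|[z0 zi]].
  by split; [rewrite -E0|move=> i; rewrite -E].
by apply: rock_rows; [rewrite E0|move=> i; rewrite E].
Qed.

Definition rock_tight (z : R) (w : 'cV[R]_d) : {set 'I_n} := [set i | (A *m w) i 0 == slack i - a i * z]%SET.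

Lemma rock_tightP z w (K : {set 'I_n}) :
  reflect (forall i, i \in K -> (A *m w) i 0 = slack i - a i * z) (K \subset rock_tight z w).
Proof.
by apply: (iffP fintype.subsetP) => H i iK; have := H i iK; rewrite inE => /eqP.
Qed.

Lemma tight_base z w : (base \in tight_rows B c (rock_pt z w)) = (z == 0).
Proof. by rewrite inE rock_base rock_rhs_base oppr_eq0. Qed.

Lemma tight_lifted z w i :
  (lifted i \in tight_rows B c (rock_pt z w)) = (i \in rock_tight z w).
Proof.
rewrite !inE rock_lifted rock_rhs_lifted mulmxDr mxE /slack.
by apply/eqP/eqP; lra.
Qed.

Lemma card_tight z w :
  #|tight_rows B c (rock_pt z w)| = ((z == 0%R) + #|rock_tight z w|)%N.
Proof.
rewrite -!sum1_card big_mkcond /= (@big_split_ord _ _ _ 1 n) big_ord1 /= tight_base.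
congr (_ + _)%N.
by rewrite [RHS]big_mkcond; apply: eq_bigr => i _; rewrite tight_lifted.
Qed.

(** As for the lifted system, a kernel vector with [sg != 0] would slide the point to [z = 0] and
    make more than [d] base rows tight. *)
Lemma rock_kernel (K : {set 'I_n}) z w sg (u : 'cV[R]_d) : (d < #|K|)%N -> K \subset rock_tight z w ->
  (forall i, i \in K -> a i * sg + (A *m u) i 0 = 0) -> sg = 0 /\ u = 0.
Proof.
move=> dK /rock_tightP wK uK.
have sg0 : sg = 0.
  apply/eqP; apply: contraTT dK => sg0; rewrite -leqNgt.
  apply: (generic_tight genA (y := w - (z / sg) *: u)) => i iK.
  rewrite mulmx_subZ wK// (_ : (A *m u) i 0 = - (a i * sg)); first by field.
  by apply/eqP; rewrite -addr_eq0 addrC uK.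
split=> //; apply: (generic_inj_ge genA (ltnW dK)) => i iK.
by have := uK i iK; rewrite sg0 mulr0 add0r.
Qed.

Lemma rock_vertex z w : Q (rock_pt z w) ->
  (d < (z == 0%R) + #|rock_tight z w|)%N -> vertex Q (rock_pt z w).
Proof.
move=> Qz dT; apply: (kernel_vertex Qz (subxx _)) => v.
have [sg [u ->]] := rock_vec_ex v => uK.
have uT i : i \in rock_tight z w -> a i * sg + (A *m u) i 0 = 0.
  by move=> iT; rewrite -rock_lifted uK// tight_lifted.
suff [-> ->] : sg = 0 /\ u = 0 by exact: rock_vec0.
have [z0|z0] := eqVneq z 0; last first.
  by apply: (rock_kernel _ (subxx _) uT); move: dT; rewrite (negbTE z0).
have sg0 : sg = 0.
  have := uK base; rewrite tight_base z0 rock_base => /(_ (eqxx _)).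
  by move/eqP; rewrite oppr_eq0 => /eqP.
split=> //; apply: (generic_inj_ge genA (K := rock_tight z w)).
  by move: dT; rewrite z0 eqxx add1n ltnS.
by move=> i /uT; rewrite sg0 mulr0 add0r.
Qed.

(** The [d] rows of [K] determine the [x] part of a kernel vector from its [z] part, so the kernel
    is the line spanned by the difference of the two points. *)
Lemma rock_adjacent (K : {set 'I_n}) z w z' w' : #|K| = d -> z != z' ->
  vertex Q (rock_pt z w) -> vertex Q (rock_pt z' w') ->
  K \subset rock_tight z w -> K \subset rock_tight z' w' ->
  Defs.adjacent Q (rock_pt z w) (rock_pt z' w').
Proof.
move=> Kd zz' vz vz' Kz Kz'.
have dz : z' - z != 0 by rewrite subr_eq0 eq_sym.
have sub y t : K \subset rock_tight t y ->
    ([set lifted i | i in K]%SET : {set 'I_n.+1}) \subset tight_rows B c (rock_pt t y).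
  move=> /fintype.subsetP Kt; apply/fintype.subsetP => _ /imsetP[i iK ->].
  by rewrite tight_lifted Kt.
apply: (tight_adjacent vz vz' _ (sub _ _ Kz) (sub _ _ Kz')).
  by move=> /rock_pt_inj[/eqP]; rewrite (negbTE zz').
move=> v; have [sg [u ->]] := rock_vec_ex v => vK.
exists (sg / (z' - z)); rewrite rock_pt_sub rock_vecZ divfK//; congr rock_vec.
apply/eqP; rewrite -subr_eq0; apply/eqP; apply: (generic_inj genA Kd) => i iK.
rewrite mulmx_subZ -(scale1r w) mulmx_subZ (rock_tightP _ _ _ Kz)// (rock_tightP _ _ _ Kz')//.
have := vK (lifted i) (imset_f _ iK); rewrite rock_lifted => /eqP.
by rewrite addrC addr_eq0 => /eqP ->; field.
Qed.

(* The projective map onto the rock extension; [apex] is the image of the point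
   at infinity. *)
Definition rock_proj y s := rock_pt (s / (1 + eta * s)) ((1 + eta * s)^-1 *: y).

Definition apex := rock_pt eta^-1 0.

Lemma mulmx_scale k (M : 'M[R]_(k, d)) t (y : 'cV_d) i : (M *m (t *: y)) i 0 = t * (M *m y) i 0.
Proof. by rewrite -scalemxAr mxE. Qed.

Lemma rock_proj_tight y s : 0 <= s ->
  rock_tight (s / (1 + eta * s)) ((1 + eta * s)^-1 *: y) = lifted_tight A slack delta y s.
Proof.
move=> s0; have t0 : 1 + eta * s != 0 by rewrite gt_eqF// ltr_pwDl// mulr_ge0// ltW.
apply/setP => i; rewrite !inE mulmx_scale /a -(inj_eq (mulfI t0)) mulVKf//.
by congr (_ == _); field.
Qed.

Lemma rock_proj_in y s : 0 <= s ->
  Q (rock_proj y s) <-> lifted_feasible A slack [set: 'I_n]%SET delta y s.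
Proof.
move=> s0; have t0 : 0 < 1 + eta * s by rewrite ltr_pwDl// mulr_ge0// ltW.
have tn := lt0r_neq0 t0.
rewrite /rock_proj rock_ptP /lifted_feasible.
have E i : ((A *m ((1 + eta * s)^-1 *: y)) i 0 <= slack i - a i * (s / (1 + eta * s))) =
   ((A *m y) i 0 <= slack i + delta i * s).
  rewrite mulmx_scale /a -(ler_pM2l t0) mulVKf//; congr (_ <= _); by field.
split=> [[_ H] i _|H]; first by rewrite -E.
by split; [rewrite divr_ge0// ltW|move=> i; rewrite E; apply: H; rewrite inE].
Qed.

Lemma delta_ge0 i : 0 <= delta i.
Proof.
have [d0 dp _ _ _] := good; have [/d0->//|iI] := boolP (i \in I0).
by rewrite ltW// dp// inE.
Qed.

(** If [eta * z >= 1], the simplex rows, where [delta] is 0, give [A_i w <= 0] and so [w = 0]; then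
    they force [eta * z = 1]. *)
Lemma rock_height z w : Q (rock_pt z w) -> rock_pt z w = apex \/ 0 < 1 - eta * z.
Proof.
move=> /rock_ptP[z0 zw]; have [//|ez] := ltP 0 (1 - eta * z); first by right.
left; have [delta0 _ _ _ _] := good.
have w0 : w = 0.
  apply: simplexI0 => i iI; apply: le_trans (zw i) _.
  by have := slack_gt0 i; rewrite /a delta0// subr0; nra.
have /card_gt0P[i iI] : (0 < #|I0|)%N by rewrite cardI0.
have := zw i; rewrite w0 mulmx0 mxE /a delta0// subr0 => H.
suff zE : eta * z = 1 by rewrite (_ : z = eta^-1)// -(mulKf (lt0r_neq0 eta_gt0) z) zE mulr1.
by have := slack_gt0 i; nra.
Qed.

(** Away from the apex the projective map is inverted by dividing by [1 - eta * z]. *)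
Lemma rock_proj_ex v : Q v -> v = apex \/ exists y s, [/\ 0 <= s, v = rock_proj y s &
  lifted_feasible A slack [set: 'I_n]%SET delta y s].
Proof.
have [z [w ->]] := rock_pt_ex v => Qv.
have [->|t0] := rock_height Qv; first by left.
right; exists ((1 - eta * z)^-1 *: w), (z / (1 - eta * z)).
have tn := lt0r_neq0 t0.
have z0 : 0 <= z by have /rock_ptP[] := Qv.
have s0 : 0 <= z / (1 - eta * z) by rewrite divr_ge0// ltW.
have E : 1 + eta * (z / (1 - eta * z)) = (1 - eta * z)^-1 by field.
have vE : rock_pt z w = rock_proj ((1 - eta * z)^-1 *: w) (z / (1 - eta * z)).
  rewrite /rock_proj E invrK scalerA divff// scale1r; congr rock_pt.
  by rewrite divfK.
by split=> //; apply/(rock_proj_in _ s0); rewrite -vE.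
Qed.

Lemma apex_tight : rock_tight eta^-1 0 = I0.
Proof.
have [d0 dp _ _ _] := good; apply/setP => i; rewrite inE mulmx0 mxE /a.
have -> : slack i - (eta * slack i - delta i) * eta^-1 = delta i / eta.
  by field; rewrite gt_eqF.
have [/d0->|iI] := boolP (i \in I0); first by rewrite mul0r eqxx.
by apply/negbTE; rewrite eq_sym gt_eqF// divr_gt0// dp// inE.
Qed.

Lemma apex_vertex : vertex Q apex.
Proof.
apply: rock_vertex; last by rewrite apex_tight cardI0 leq_addl.
apply/rock_ptP; split=> [|i]; first by rewrite invr_ge0 ltW.
rewrite mulmx0 mxE /a (_ : _ - _ = delta i / eta); last by field; rewrite gt_eqF.
by rewrite divr_ge0 ?delta_ge0// ltW.
Qed.

Lemma rock_tight_card v : Q v -> (#|tight_rows B c v| <= d.+1)%N.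
Proof.
have [_ _ tightp _ _] := good.
move=> /rock_proj_ex[->|[y [s [s0 -> _]]]].
  by rewrite card_tight apex_tight cardI0 invr_eq0 gt_eqF.
rewrite card_tight rock_proj_tight// mulf_eq0 invr_eq0.
have -> : (1 + eta * s == 0) = false by rewrite gt_eqF// ltr_pwDl// mulr_ge0// ltW.
have [sE|sn] := eqVneq s 0; last first.
  have := tightp y s; rewrite finset.setTI; apply.
  by rewrite lt0r sn.
rewrite /= add1n ltnS; apply: (generic_tight genA (y := y)) => i.
by rewrite inE sE mulr0 addr0 => /eqP.
Qed.

(** The map [s |-> s / (1 + eta * s)] is increasing and stays below [eta^-1], so consecutive points
    differ in [z] and [rock_adjacent] applies; unbounded edges end at [apex]. *)
Lemma rock_climb k y s : climb A slack [set: 'I_n]%SET delta k y s -> 0 <= s ->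
  vertex Q (rock_proj y s) -> exists p : seq 'cV[R]_d.+1,
    [/\ path (fun u v => `[< Defs.adjacent Q u v >]) (rock_proj y s) p,
      last (rock_proj y s) p = apex & (size p <= k)%N].
Proof.
elim=> {k y s} [k y s K _ Kd Kt K0|k y s y' s' K _ Kd Kt Kt' s'0 ss' fe td _ IH] s0 vy.
  exists [:: apex]; split=> //=; rewrite andbT; apply/asboolP.
  have t0 : 0 < 1 + eta * s by rewrite ltr_pwDl// mulr_ge0// ltW.
  apply: (rock_adjacent Kd _ vy apex_vertex).
  - by rewrite lt_eqF// ltr_pdivrMr// ltr_pdivlMl//; lra.
  - by rewrite rock_proj_tight.
  - apply/rock_tightP => i iK; rewrite mulmx0 mxE /a K0//.
    by field; rewrite gt_eqF.
have s'0' := ltW s'0.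
have vy' : vertex Q (rock_proj y' s').
  apply: rock_vertex; first exact/rock_proj_in.
  by rewrite rock_proj_tight// addnC ltn_addr//; rewrite finset.setTI in td.
have [p [pp pl ps]] := IH s'0' vy'.
exists (rock_proj y' s' :: p); split=> //=; rewrite pp andbT; apply/asboolP.
have t0 : 0 < 1 + eta * s by rewrite ltr_pwDl// mulr_ge0// ltW.
have t0' : 0 < 1 + eta * s' by rewrite ltr_pwDl// mulr_ge0// ltW.
apply: (rock_adjacent Kd _ vy vy'); rewrite ?rock_proj_tight//.
by rewrite lt_eqF// ltr_pdivrMr// mulrAC ltr_pdivlMr//; nra.
Qed.

(** Halfway from [x0] to the apex, row [i] keeps the slack [slack i / 2 + delta i / (2 * eta)]. *)
Lemma rock_interior : strictly_feasible B c (rock_pt (2 * eta)^-1 0).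
Proof.
have z0 : 0 < (2 * eta)^-1 by rewrite invr_gt0 mulr_gt0.
apply: rock_rows.
  by rewrite rock_base rock_rhs_base oppr_lt0.
move=> i; rewrite rock_lifted rock_rhs_lifted addr0.
have := slack_gt0 i; have := delta_ge0 i; rewrite {1}/slack.
have : eta * (2 * eta)^-1 = 2^-1 by field; rewrite gt_eqF.
by rewrite /a /slack; move: z0; nra.
Qed.

(** For a lifted row, a facet point of the base is raised to a small height [eps], and its offset
    [w] from [x0] is rescaled to stay on the row. *)
Lemma rock_irredundant k : exists x, irredundant_at B c k x.
Proof.
move: k; apply: rock_rows.
  exists (rock_pt 0 0); split; first by rewrite rock_base rock_rhs_base oppr0.
  apply: rock_rows; first by rewrite eqxx.
  move=> i _; rewrite rock_lifted rock_rhs_lifted addr0 mulr0 add0r.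
  by have := slack_gt0 i; rewrite /slack subr_gt0.
move=> i; have [[x [xi xj]]|one] := irrA i; last first.
  exists apex; split.
    have : lifted i \in tight_rows B c apex.
      rewrite tight_lifted apex_tight.
      have /card_gt0P[j] : (0 < #|I0|)%N by rewrite cardI0.
      by rewrite (one j).
    by rewrite inE => /eqP.
  apply: rock_rows.
    by move=> _; rewrite rock_base rock_rhs_base oppr_lt0 invr_gt0.
  by move=> j; rewrite (one j) eqxx.
pose w := x - 1 *: x0.
have wi : (A *m w) i 0 = slack i by rewrite mulmx_subZ mul1r xi.
have wj j : j != i -> 0 < slack j - (A *m w) j 0.
  by move=> /xj; rewrite mulmx_subZ /slack; lra.
(* This [t] makes the scaling by [1 - t * eps] cancel the term [a i * eps] of row [i]. *)
pose t := a i / slack i.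
have tE : t * slack i = a i by rewrite divfK// gt_eqF.
have [|eps eps0 epsP] := @small_perturbation R n (fun j => j != i)
  (fun j => slack j - (A *m w) j 0) (fun j => a j - t * (A *m w) j 0).
  by move=> j /wj.
exists (rock_pt eps ((1 - t * eps) *: w)).
have row j : (B *m rock_pt eps ((1 - t * eps) *: w)) (lifted j) 0 =
    (A *m x0) j 0 + (A *m w) j 0 + eps * (a j - t * (A *m w) j 0).
  by rewrite rock_lifted mulmx_addZ; ring.
split.
  rewrite row rock_rhs_lifted wi tE subrr mulr0 addr0 /slack; ring.
apply: rock_rows.
  by move=> _; rewrite rock_base rock_rhs_base oppr_lt0.
move=> j; rewrite (inj_eq (@rshift_inj 1 n)) => ji.
rewrite row rock_rhs_lifted; have := epsP j ji.
have := ler_wpM2l (ltW eps0) (ler_norm (a j - t * (A *m w) j 0)).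
by rewrite /slack; lra.
Qed.

Lemma rock_bounded : bounded_set Q.
Proof.
have [M [_ /(_ (M + 1) (ltr_pwDr ltr01 (lexx M)))]] := bndP.
move: (M + 1) => {}M PM.
exists (`|M| + eta^-1); split; first exact: num_real.
move=> N leN v Qv; apply: le_trans (ltW leN); rewrite /=.
have e0 : 0 < eta^-1 by rewrite invr_gt0.
move: Qv; have [z [w ->]] := rock_pt_ex v => Qv.
have [z0 zw] := (rock_ptP z w).1 Qv.
have zle : z <= eta^-1.
  have [/rock_pt_inj[->]//|] := rock_height Qv.
  by rewrite -[eta^-1]mulr1 ler_pdivlMl//; lra.
have Px : polyhedron A b (x0 + w).
  move=> i; rewrite mulmxDr mxE; have := zw i.
  by have := mulr_ge0 (ltW (lift_coef_gt0 i)) z0; rewrite /slack; lra.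
rewrite [leLHS]/Num.norm /= mx_normrE; apply/bigmax_leP; split.
  by rewrite addr_ge0// ltW.
move=> [k l] _ /=; rewrite /rock_pt !ord1.
have [j ->|j ->] := @split_ordP 1 d k.
  by rewrite ord1 rock_vec_top ger0_norm//; have := normr_ge0 M; lra.
rewrite rock_vec_bot.
suff : `|(x0 + w) j 0| <= M by have := ler_norm M; lra.
apply: le_trans (PM _ Px); rewrite /= [leRHS]/Num.norm /= mx_normrE.
by apply: (le_trans _ (le_bigmax _ _ (j, 0))).
Qed.

Lemma rock_extension_exists : exists Q' : set 'cV[R]_(d.+1),
  [/\ extension Q' (polyhedron A b), simple_polytope d.+1 Q',
      [set F | facet Q' F] #= `I_(n.+1) &
      exists D : nat, is_diameter Q' D /\ (D <= 2 * (n - d))%N].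
Proof.
exists Q.
have polyQ : polytope Q by split; [exact: rock_bounded|exists n.+1, B, c].
have int : exists x, strictly_feasible B c x by eexists; exact: rock_interior.
split.
(* The projection forgets [z]. As [a i > 0], a positive [z] only tightens the rows, and the slice
   [z = 0] is the base. *)
- split=> //; exists (dsubmx : {linear 'cV[R]_(1 + d) -> 'cV[R]_d}).
  apply/seteqP; split => x /=.
    move=> [v Qv <-]; move: Qv; have [z [w ->]] := rock_pt_ex v => /rock_ptP[z0 zw].
    rewrite /rock_pt /rock_vec col_mxKd => i; rewrite mulmxDr mxE.
    by have := zw i; have := mulr_ge0 (ltW (lift_coef_gt0 i)) z0; rewrite /slack; lra.
  move=> Px; exists (rock_vec 0 x); last by rewrite /rock_vec col_mxKd.
  have -> : rock_vec 0 x = rock_pt 0 (x - 1 *: x0).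
    by rewrite /rock_pt scale1r addrC subrK.
  apply/rock_ptP; split=> // i; rewrite mulmx_subZ /slack.
  by have := Px i; lra.
- split=> //; first exact: polyhedron_has_dim.
  move=> v vv; have Qv := vertex_in vv.
  have := card_facets_at int rock_irredundant Qv.
  (* The lower bound is the rank condition at a vertex, the upper bound comes from the generic
     lift. *)
  suff -> : #|tight_rows B c v| = d.+1 by [].
  apply/eqP; rewrite eqn_leq rock_tight_card//=.
  exact/kernel_trivial_card/vertex_kernel.
- by apply: card_facets => //; exact: rock_irredundant.
have -> : (n - d = r.+1)%N by rewrite [X in (X - _)%N]nE addSnnS addKn.
apply: (@diameter_from_apex _ _ _ apex); first exact: adjacent_sym.
move=> v vv; have := vv.
have [->|[y [s [s0 vE fe]]]] := rock_proj_ex (vertex_in vv); first by exists [::].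
rewrite vE => vys; apply: rock_climb => //.
have := kernel_trivial_card (vertex_kernel vys).
rewrite card_tight rock_proj_tight// mulf_eq0 invr_eq0.
have -> : (1 + eta * s == 0) = false by rewrite gt_eqF// ltr_pwDl// mulr_ge0// ltW.
have [_ _ _ climb0 climbp] := good.
(* On the base, one of the tight rows is [z >= 0] itself and the climb has length [r.+1]; above it,
   length [r] suffices. *)
have [sE|sn] := eqVneq s 0.
  rewrite /= add1n ltnS => dT; rewrite sE; apply: climb0; first by rewrite -sE.
  by rewrite finset.setTI -sE.
rewrite /= add0n => dT; apply: (@climb_monotone _ _ _ _ _ _ _ r) => //.
apply: climbp => //; first by rewrite lt0r sn.
by rewrite finset.setTI.
Qed.

End RockExtension.


(** * Totally non-degenerate systems *)

Section Nondegenerate.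
Variables (R : realType) (d m : nat) (A : 'M[R]_(m, d)) (b : 'cV[R]_m).
Hypothesis tndA : totally_nondegenerate_system A b.

Lemma hyperplane_rowE i x : hyperplane (row i A) (b i 0) x <-> (A *m x) i 0 = b i 0.
Proof. by rewrite /hyperplane /= -row_mul mxE. Qed.

Lemma nondegenerate_tight (K : {set 'I_m}) (x : 'cV_d) :
  (forall i, i \in K -> (A *m x) i 0 = b i 0) -> (#|K| <= d)%N.
Proof.
have [_ _ /(_ K)[_ K0]] := tndA => Kx; rewrite leqNgt; apply/negP => /K0 I0.
suff : set0 x by [].
by rewrite -I0 => i /Kx /hyperplane_rowE.
Qed.

Lemma nondegenerate_kernel (K : {set 'I_m}) : (0 < #|K| <= d)%N ->
  exists2 W : {vspace 'cV[R]_d}, \dim W = (d - #|K|)%N &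
    forall u, u \in W <-> forall i, i \in K -> (A *m u) i 0 = 0.
Proof.
have [_ _ /(_ K)[KV _]] := tndA => /KV[p [W [dW IE]]]; exists W => // u.
have Kp i : i \in K -> (A *m p) i 0 = b i 0.
  have : [set x | x - p \in W] p by rewrite /= subrr mem0v.
  by rewrite -IE => H iK; apply/hyperplane_rowE; exact: H.
have uE : (u \in W) = ((p + 1 *: u) - p \in W) by rewrite scale1r addrAC subrr add0r.
rewrite uE; split=> [uW i iK|uK].
  have : [set x | x - p \in W] (p + 1 *: u) by [].
  by rewrite -IE => /(_ i iK)/hyperplane_rowE; rewrite mulmx_addZ Kp//; lra.
suff : [set x | x - p \in W] (p + 1 *: u) by [].
by rewrite -IE => i iK; apply/hyperplane_rowE; rewrite mulmx_addZ Kp// uK//; lra.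
Qed.

(** The common kernel has dimension [d - #|K|], so by rank-nullity the rows of [K] map onto all
    value vectors. *)
Lemma nondegenerate_solve (K : {set 'I_m}) (c : 'I_m -> R) : (#|K| <= d)%N ->
  exists u : 'cV_d, forall i, i \in K -> (A *m u) i 0 = c i.
Proof.
move=> Kd; have [K0|K0] := posnP #|K|.
  by exists 0 => i; rewrite (cards0_eq K0) inE.
have [W dW WE] := @nondegenerate_kernel K (introT andP (conj K0 Kd)).
pose M := \matrix_(i < #|K|, j < d) A (enum_val i) j.
have ME u i : (M *m u) i 0 = (A *m u) (enum_val i) 0.
  by rewrite !mxE; apply: eq_bigr => j _; rewrite mxE.
pose f : 'Hom('cV[R]_d, 'cV[R]_#|K|) := linfun (mulmx M).
have kf : lker f = W.
  apply/vspaceP => u; rewrite memv_ker lfunE /=; apply/eqP/idP => [Mu|/WE uK].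
    by apply/WE => i iK; rewrite -(enum_rankK_in iK iK) -ME Mu mxE.
  by apply/colP => i; rewrite ME [RHS]mxE uK// enum_valP.
have df : \dim (limg f) = #|K|.
  have := limg_ker_dim f fullv; rewrite kf capfv dW dimvf /dim /= muln1 => H.
  by apply/eqP; rewrite -(eqn_add2l (d - #|K|)) H subnK.
have : (\col_(i < #|K|) c (enum_val i)) \in limg f.
  suff -> : limg f = fullv by exact: memvf.
  by apply/eqP; rewrite -(dimv_leqif_eq (subvf _)) df dimvf /dim /= muln1.
move=> /memv_imgP[u _ uE]; exists u => i iK.
move/colP/(_ (enum_rank_in iK i)): uE.
by rewrite mxE lfunE /= ME enum_rankK_in// => ->.
Qed.

Lemma nondegenerate_inj (K : {set 'I_m}) (u : 'cV_d) : #|K| = d ->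
  (forall i, i \in K -> (A *m u) i 0 = 0) -> u = 0.
Proof.
move=> Kd uK; have [K0|K0] := posnP #|K|.
  by move: u {uK}; rewrite -Kd K0 => u; exact: flatmx0.
have [|W dW WE] := @nondegenerate_kernel K; first by rewrite K0 Kd leqnn.
move: dW; rewrite Kd subnn => /eqP; rewrite dimv_eq0 => /eqP W0.
by apply/eqP; rewrite -memv0 -W0; apply/WE.
Qed.

Lemma nondegenerate_generic x0 : generic_system A (slack A b x0).
Proof.
split; [by move=> K ? c; exact: nondegenerate_solve|exact: nondegenerate_inj|].
move=> K y Ky; apply: (@nondegenerate_tight K (x0 + y)) => i iK.
by rewrite mulmxDr mxE Ky// /slack addrC subrK.
Qed.

(** At most [d] rows are tight at a feasible point, so some direction decreases all of them at rate
    1; a short step suffices. *)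
Lemma nondegenerate_interior : exists x, strictly_feasible A b x.
Proof.
have [[x Px] _ _] := tndA.
have Kd : (#|tight_rows A b x| <= d)%N.
  by apply: (@nondegenerate_tight _ x) => i; rewrite inE => /eqP.
have [u uK] := nondegenerate_solve (fun=> -1) Kd.
have [i|eps eps0 epsP] := @small_perturbation R m (fun i => i \notin tight_rows A b x)
    (fun i => b i 0 - (A *m x) i 0) (fun i => (A *m u) i 0).
  by rewrite inE subr_gt0 lt_neqAle => ->; exact: Px.
exists (x + eps *: u) => i; rewrite mulmx_addZ.
have [it|it] := boolP (i \in tight_rows A b x).
  by rewrite uK//; have := Px i; lra.
by have := epsP i it; have := ler_wpM2l (ltW eps0) (ler_norm ((A *m u) i 0)); lra.
Qed.

Lemma row'_polyhedron i x : polyhedron (row' i A) (row' i b) x <->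
  forall j, j != i -> (A *m x) j 0 <= b j 0.
Proof.
have E j : (row' i A *m x) j 0 = (A *m x) (lift i j) 0.
  by rewrite !mxE; apply: eq_bigr => k _; rewrite mxE.
split=> [H j|H j]; last by rewrite E [leRHS]mxE; apply: H; rewrite eq_sym neq_lift.
by rewrite eq_sym => /unlift_some[k -> _]; have := H k; rewrite E [leRHS]mxE.
Qed.

Lemma row'_nondegenerate i : totally_nondegenerate_system (row' i A) (row' i b).
Proof.
have [[x Px] An AK] := tndA; split.
- by exists x; apply/row'_polyhedron => j _; exact: Px.
- by move=> j; have := An (lift i j); congr (_ != _); apply/rowP => k; rewrite !mxE.
move=> K; have := AK [set lift i j | j in K]%SET.
rewrite card_imset; last exact: lift_inj.
suff -> : \bigcap_(k in [set` [set lift i j | j in K]%SET]) hyperplane (row k A) (b k 0) =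
  \bigcap_(j in [set` K]) hyperplane (row j (row' i A)) (row' i b j 0) by [].
have E j : hyperplane (row j (row' i A)) (row' i b j 0) =
    hyperplane (row (lift i j) A) (b (lift i j) 0).
  by rewrite mxE; congr hyperplane; apply/rowP => k; rewrite !mxE.
apply/seteqP; split=> y /= H.
  by move=> j jK; rewrite E; apply: H; rewrite /= imset_f.
by move=> _ /imsetP[j jK ->]; rewrite -E; exact: H.
Qed.

(** Some [y] violates row [i] only. The segment to it from an interior point meets the hyperplane of
    row [i] where all other rows are strict. *)
Lemma row'_irredundant i : polyhedron A b <> polyhedron (row' i A) (row' i b) ->
  exists x, irredundant_at A b i x.
Proof.
move=> neq; have [x0 sx0] := nondegenerate_interior.
have [y yj yi] : exists2 y : 'cV[R]_d, forall j, j != i -> (A *m y) j 0 <= b j 0 &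
    b i 0 < (A *m y) i 0.
  apply: contrapT => no; apply: neq; apply/seteqP; split => y.
    by move=> Py; apply/row'_polyhedron => j _; exact: Py.
  move=> /row'_polyhedron H j; have [->|/H//] := eqVneq j i.
  by rewrite leNgt; apply/negP => yi; apply: no; exists y.
pose t := (b i 0 - (A *m x0) i 0) / ((A *m y) i 0 - (A *m x0) i 0).
have x0i := sx0 i.
have q0 : 0 < (A *m y) i 0 - (A *m x0) i 0 by lra.
have tE : t * ((A *m y) i 0 - (A *m x0) i 0) = b i 0 - (A *m x0) i 0.
  by rewrite divfK// gt_eqF.
have t0 : 0 < t by rewrite divr_gt0// subr_gt0.
have t1 : t < 1 by rewrite ltr_pdivrMr// mul1r; lra.
exists (x0 + t *: (y - 1 *: x0)).
have E j : (A *m (x0 + t *: (y - 1 *: x0))) j 0 =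
    (A *m x0) j 0 + t * ((A *m y) j 0 - (A *m x0) j 0).
  by rewrite mulmx_addZ mulmx_subZ mul1r.
split; first by rewrite E tE addrC subrK.
move=> j ji; rewrite E; have := sx0 j; have := yj j ji; nra.
Qed.

End Nondegenerate.

(** * Minimal presentations, dimension 0 and the final assembly *)

Lemma minimal_nondegenerate (R : realType) d (P : set 'cV[R]_d) :
  totally_nondegenerate P -> exists m (A : 'M[R]_(m, d)) (b : 'cV[R]_m),
    [/\ totally_nondegenerate_system A b, P = polyhedron A b &
        forall i, exists x, irredundant_at A b i x].
Proof.
move=> [_ [m0 [A0 [b0 [tnd0 PE0]]]]].
pose good m := exists A : 'M[R]_(m, d), exists b : 'cV[R]_m,
  totally_nondegenerate_system A b /\ P = polyhedron A b.
have ex : exists m, `[< good m >] by exists m0; apply/asboolP; exists A0, b0.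
have [m /asboolP[A [b [tnd PE]]] mmin] := ex_minnP ex.
(* Dropping a row preserves total non-degeneracy, so by minimality of [m] it must change the
   polyhedron. *)
exists m, A, b; split=> // i; apply: row'_irredundant => // E.
have : (m <= m.-1)%N.
  apply: mmin; apply/asboolP; exists (row' i A), (row' i b); split; last by rewrite PE.
  exact: row'_nondegenerate.
by rewrite leqNgt ltn_predL (leq_trans _ (ltn_ord i)).
Qed.

Lemma generic_rock_extension (R : realType) d n (A : 'M[R]_(n, d)) (b : 'cV[R]_n) x0 :
  strictly_feasible A b x0 -> generic_system A (slack A b x0) ->
  bounded_set (polyhedron A b) ->
  (forall i, (exists x, irredundant_at A b i x) \/ (forall j, j = i)) ->
  (forall u : 'cV_d, exists i, 0 <= (A *m u) i 0) ->
  exists Q : set 'cV[R]_(d.+1),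
    [/\ extension Q (polyhedron A b), simple_polytope d.+1 Q,
        [set F | facet Q F] #= `I_(n.+1) &
        exists delta : nat, is_diameter Q delta /\ (delta <= 2 * (n - d))%N].
Proof.
move=> sx0 genA bndP irrA Au.
have sl0 i : 0 < slack A b x0 i by rewrite subr_gt0.
have [I0 [cI0 sI0]] := simplex_rows genA Au.
have nE : n = (d.+1 + (n - d.+1))%N.
  by rewrite subnKC// -cI0 -[leqRHS]card_ord max_card.
have [delta good] := good_lift_exists genA cI0 sI0 nE.
have [i|eta eta0 etaP] := @eventually_forall_fin R 'I_n
  (fun i D => delta i < D * slack A b x0 i).
  exists ((`|delta i| + 1) / slack A b x0 i) => D leD.
  rewrite ler_pdivrMr// in leD; apply: lt_le_trans leD.
  by rewrite (le_lt_trans (ler_norm _))// ltrDl.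
exact: (rock_extension_exists nE sl0 genA cI0 sI0 bndP irrA good eta0 (etaP eta (lexx _))).
Qed.

Lemma bounded_nonneg_row (R : realType) d n (A : 'M[R]_(n, d.+1)) (b : 'cV[R]_n) x0 :
  polyhedron A b x0 -> bounded_set (polyhedron A b) ->
  forall u : 'cV_d.+1, exists i, 0 <= (A *m u) i 0.
Proof.
move=> Px0 bnd.
have H (u : 'cV[R]_d.+1) : u != 0 -> exists i, 0 <= (A *m u) i 0.
  move=> u0; apply: contrapT => /forallNP no; move/eqP: u0; apply.
  apply: (bounded_ray (x := x0) bnd) => t t0 i; rewrite mulmx_addZ.
  have /negP := no i; rewrite -ltNge => ui; have := Px0 i; nra.
(* For [u = 0] some row must be exhibited; a nonzero direction, present in dimension [d.+1],
   provides one. *)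
move=> u; have [->|/H//] := eqVneq u 0.
have [|i _] := H (const_mx 1); last by exists i; rewrite mulmx0 mxE.
by apply/eqP => /matrixP/(_ 0 0)/eqP; rewrite !mxE oner_eq0.
Qed.

(** The point has dimension 0, so its facets have dimension -1: only the empty face, cut out by the
    functional 0 at level 1. *)
Lemma facets_point (R : realType) (P : set 'cV[R]_0) :
  P 0 -> [set F | facet P F] = [set set0].
Proof.
move=> P0; have PT : P = [set: 'cV[R]_0].
  by apply/seteqP; split=> // x _; rewrite (flatmx0 x).
have dimP (F : set 'cV[R]_0) : F 0 -> has_dim F 0.
  move=> F0; suff : has_dim F (\dim (0%VS : {vspace 'cV[R]_0}))%:Z by rewrite dimv0.
  apply: (has_dim_spanned (p := 0)) => // [x _|u _].
    by rewrite (flatmx0 (x - 0)) mem0v.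
  by exists 1; rewrite ?oner_eq0// (flatmx0 (_ + _)).
apply/seteqP; split=> F /=.
  move=> [_ [q [Pq Fq]]]; apply/seteqP; split=> // x; rewrite (flatmx0 x) => F0.
  have := has_dim_uniq Fq (dimP _ F0); have := has_dim_uniq Pq (dimP _ P0).
  by move=> ->.
move=> ->; split.
  exists 0, 1; split=> [x _|]; first by rewrite mul0mx mxE ler01.
  apply/seteqP; split=> // x [_]; rewrite /hyperplane /= mul0mx mxE => /eqP.
  by rewrite eq_sym oner_eq0.
by exists 0; split; [exact: dimP|left].
Qed.

(* The system [0 <= 1] presents the point of [R^0] with its one (empty) facet. *)
Lemma rock_extension_point (R : realType) (P : set 'cV[R]_0) :
  P 0 -> bounded_set P -> exists Q : set 'cV[R]_1,
    [/\ extension Q P, simple_polytope 1 Q, [set F | facet Q F] #= `I_2 &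
        exists delta : nat, is_diameter Q delta /\ (delta <= 2 * (1 - 0))%N].
Proof.
move=> P0; pose A : 'M[R]_(1, 0) := 0; pose b : 'cV[R]_1 := const_mx 1.
have -> : P = polyhedron A b.
  apply/seteqP; split=> x _; last by rewrite (flatmx0 x).
  by move=> i; rewrite /A mul0mx !mxE ler01.
have sl i : slack A b 0 i = 1 by rewrite /slack mulmx0 !mxE subr0.
move=> bnd; apply: (generic_rock_extension (x0 := 0)) => //.
- by move=> i; rewrite mulmx0 !mxE ltr01.
- split=> [K|K u _ _|K y Ky].
  + by rewrite leqn0 cards_eq0 => /eqP-> c; exists 0 => i; rewrite inE.
  + exact: flatmx0.
  + rewrite leqn0 cards_eq0 -finset.subset0; apply/fintype.subsetP => i /Ky /eqP.
    by rewrite sl /A mul0mx mxE eq_sym oner_eq0.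
- by move=> i; right=> j; rewrite !ord1.
- by move=> u; exists ord0; rewrite /A mul0mx mxE.
Qed.

Theorem corollary2p8 (R : realType) (d n : nat) (P : set 'cV[R]_d) :
  totally_nondegenerate P ->
  has_dim P d%:Z ->
  [set F | facet P F] #= `I_n ->
  exists Q : set 'cV[R]_(d.+1),
    [/\ extension Q P,
        simple_polytope d.+1 Q,
        [set F | facet Q F] #= `I_(n.+1) &
        exists delta : nat, is_diameter Q delta /\ (delta <= 2 * (n - d))%N].
Proof.
move=> tndP _ cardP; have [bnd _] := tndP.1.
have [m [A [b [tnd PE irr]]]] := minimal_nondegenerate tndP.
case: d P A tndP cardP bnd tnd PE irr => [|d] P A tndP cardP bnd tnd PE irr.
  have P0 : P 0 by have [[x Px] _ _] := tnd; rewrite PE -(flatmx0 x).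
  suff -> : n = 1%N by exact: rock_extension_point.
  apply/esym/card_eq_II; apply: card_eq_trans _ cardP.
  by rewrite facets_point// card_eq_sym card_set1.
have [x0 sx0] := nondegenerate_interior tnd.
(* Irredundant rows correspond one to one to facets. *)
have mn : m = n.
  apply/card_eq_II; rewrite -(card_eqr cardP) card_eq_sym PE.
  by apply: card_facets => //; exists x0.
rewrite -mn PE; rewrite PE in bnd; apply: (generic_rock_extension sx0) => //.
- exact: nondegenerate_generic.
- by move=> i; left.
- by apply: (bounded_nonneg_row _ bnd); exact: strictly_feasible_in sx0.
Qed.
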